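(* Suppose a sequence of nondegenerate C-stationary points $x^{t}\in M^{\text{D}(t)}$ of $\text{D}(t)$ with quadratic and biactive indices $\text{DISJ-}QI$ and $\text{DISJ-}BI$, respectively, converges to $\bar x$ for $t\to 0$. If $\bar x\in M$ is a nondegenerate C-stationary point of MPCC with multipliers $(\bar\sigma,\bar\varrho)$, then its quadratic and biactive indices $\text{MPCC-}QI$ and $\text{MPCC-}BI$ satisfy $$\max\{\text{DISJ-}QI-s,0\}\le\text{MPCC-}QI\le\text{DISJ-}QI,\qquad \text{MPCC-}BI=\text{DISJ-}BI,$$ where $$s=\left|\{j\in a_{01}(\bar x)\mid\bar\sigma_{1,j}=0\}\right|+\left|\{j\in a_{10}(\bar x)\mid\bar\sigma_{2,j}=0\}\right|.$$ Thus, for its C-index, $$\max\{\text{DISJ-}CI-s,0\}\le\text{MPCC-}CI\le\text{DISJ-}CI.$$ If additionally MPCC-ND4 holds at $\bar x$, then $\text{MPCC-}QI=\text{DISJ-}QI$, and also $\text{MPCC-}CI=\text{DISJ-}CI$.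
   Context: Let $f\in C^2(\mathbb{R}^n,\mathbb{R})$, $F_1,F_2\in C^2(\mathbb{R}^n,\mathbb{R}^\kappa)$. MPCC is the problem $\min f(x)$ s.t. $x\in M$ with $M=\{x\in\mathbb{R}^n \mid F_{1,j}(x)\cdot F_{2,j}(x)=0,\ F_{1,j}(x)\ge 0,\ F_{2,j}(x)\ge 0,\ j=1,\ldots,\kappa\}$. For $t>0$, the disjunctive regularization $\text{D}(t)$ is the problem $\min f(x)$ s.t. $x\in M^{\text{D}(t)}$ with $M^{\text{D}(t)}=\{x\in\mathbb{R}^n \mid \max\{t-F_{1,j}(x),t-F_{2,j}(x)\}\ge 0,\ F_{1,j}(x)\ge 0,\ F_{2,j}(x)\ge 0,\ j=1,\ldots,\kappa\}$. In the claim, $t$ runs through positive parameters tending to $0$, and all $x^t$ have the same indices $\text{DISJ-}QI$, $\text{DISJ-}BI$. MPCC notions. For $\bar x\in M$: $a_{01}(\bar x)=\{j\mid F_{1,j}(\bar x)=0,F_{2,j}(\bar x)>0\}$, $a_{10}(\bar x)=\{j\mid F_{1,j}(\bar x)>0,F_{2,j}(\bar x)=0\}$, $a_{00}(\bar x)=\{j\mid F_{1,j}(\bar x)=F_{2,j}(\bar x)=0\}$. MPCC-LICQ at $\bar x$: the vectors $\nabla F_{1,j}(\bar x)$, $j\in a_{01}(\bar x)\cup a_{00}(\bar x)$, and $\nabla F_{2,j}(\bar x)$, $j\in a_{10}(\bar x)\cup a_{00}(\bar x)$, are linearly independent. $\bar x\in M$ is C-stationary for MPCC if there exist multipliers $\bar\sigma_{1,j}$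 ($j\in a_{01}(\bar x)$), $\bar\sigma_{2,j}$ ($j\in a_{10}(\bar x)$), $\bar\varrho_{1,j},\bar\varrho_{2,j}$ ($j\in a_{00}(\bar x)$) with $\nabla L(\bar x)=0$ and $\bar\varrho_{1,j}\cdot\bar\varrho_{2,j}\ge 0$ for all $j\in a_{00}(\bar x)$, where $$L(x)=f(x)-\sum_{j\in a_{01}(\bar x)}\bar\sigma_{1,j}F_{1,j}(x)-\sum_{j\in a_{10}(\bar x)}\bar\sigma_{2,j}F_{2,j}(x)-\sum_{j\in a_{00}(\bar x)}\left(\bar\varrho_{1,j}F_{1,j}(x)+\bar\varrho_{2,j}F_{2,j}(x)\right).$$ Tangent space: $\mathcal{T}_{\bar x}=\{\xi\in\mathbb{R}^n\mid\nabla^TF_{1,j}(\bar x)\xi=0,\ j\in a_{01}(\bar x)\cup a_{00}(\bar x);\ \nabla^TF_{2,j}(\bar x)\xi=0,\ j\in a_{10}(\bar x)\cup a_{00}(\bar x)\}$. A C-stationary point $\bar x$ is nondegenerate if: MPCC-ND1: MPCC-LICQ holds at $\bar x$ (so the multipliers are unique); MPCC-ND2: $\bar\varrho_{1,j}\cdot\bar\varrho_{2,j}>0$ for all $j\in a_{00}(\bar x)$; MPCC-ND3: the restricted Hessian $D^2L(\bar x)\restriction_{\mathcal{T}_{\bar x}}$ is nonsingular (as a quadratic form on $\mathcal{T}_{\bar x}$). Condition MPCC-ND4: $\bar\sigma_{1,j}\neq 0$ for all $j\in a_{01}(\bar x)$ and $\bar\sigma_{2,j}\ne 0$ for all $j\in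 a_{10}(\bar x)$. For a nondegenerate C-stationary point: $\text{MPCC-}QI$ is the number of negative eigenvalues of $D^2L(\bar x)\restriction_{\mathcal{T}_{\bar x}}$; $\text{MPCC-}BI$ is the number of $j\in a_{00}(\bar x)$ with $\bar\varrho_{1,j},\bar\varrho_{2,j}<0$; $\text{MPCC-}CI=\text{MPCC-}QI+\text{MPCC-}BI$. $\text{D}(t)$ notions. For $x\in M^{\text{D}(t)}$: $\mathcal{H}_{12}(x)=\{j\mid F_{1,j}(x)=F_{2,j}(x)=t\}$, $\mathcal{H}_{1}(x)=\{j\mid F_{1,j}(x)=t,F_{2,j}(x)>t\}$, $\mathcal{H}_{2}(x)=\{j\mid F_{1,j}(x)>t,F_{2,j}(x)=t\}$, $\mathcal{N}_1(x)=\{j\mid F_{1,j}(x)=0\}$, $\mathcal{N}_2(x)=\{j\mid F_{2,j}(x)=0\}$. DISJ-LICQ at $x$: the vectors $\nabla F_{1,j}(x)$, $j\in\mathcal{H}_{12}(x)\cup\mathcal{H}_1(x)\cup\mathcal{N}_1(x)$, and $\nabla F_{2,j}(x)$, $j\in\mathcal{H}_{12}(x)\cup\mathcal{H}_2(x)\cup\mathcal{N}_2(x)$, are linearly independent. $x\in M^{\text{D}(t)}$ is C-stationary for $\text{D}(t)$ if there exist multipliers $\zeta_{1,j},\zeta_{2,j}\ge 0$ ($j\in\mathcal{H}_{12}(x)$), $\eta_{1,j}\ge 0$ ($j\in\mathcal{H}_1(x)$), $\eta_{2,j}\ge 0$ ($j\in\mathcal{H}_2(x)$), $\nu_{1,j}\ge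 0$ ($j\in\mathcal{N}_1(x)$), $\nu_{2,j}\ge 0$ ($j\in\mathcal{N}_2(x)$) such that the gradient at $y=x$ of the Lagrange function (index sets and multipliers fixed at $x$) $$L^{\text{D}(t)}(y)=f(y)-\sum_{j\in\mathcal{H}_{12}(x)}\left(\zeta_{1,j}(t-F_{1,j}(y))+\zeta_{2,j}(t-F_{2,j}(y))\right)-\sum_{j\in\mathcal{H}_1(x)}\eta_{1,j}(t-F_{1,j}(y))-\sum_{j\in\mathcal{H}_2(x)}\eta_{2,j}(t-F_{2,j}(y))-\sum_{j\in\mathcal{N}_1(x)}\nu_{1,j}F_{1,j}(y)-\sum_{j\in\mathcal{N}_2(x)}\nu_{2,j}F_{2,j}(y)$$ vanishes. Tangent space: $\mathcal{T}^{\text{D}(t)}_{x}=\{\xi\in\mathbb{R}^n\mid\nabla^TF_{1,j}(x)\xi=0,\ j\in\mathcal{H}_{12}(x)\cup\mathcal{H}_1(x)\cup\mathcal{N}_1(x);\ \nabla^TF_{2,j}(x)\xi=0,\ j\in\mathcal{H}_{12}(x)\cup\mathcal{H}_2(x)\cup\mathcal{N}_2(x)\}$. A C-stationary point $x$ of $\text{D}(t)$ is nondegenerate if: DISJ-ND1: DISJ-LICQ holds at $x$; DISJ-ND2: all the multipliers $\zeta_{1,j},\zeta_{2,j}$ ($j\in\mathcal{H}_{12}(x)$), $\eta_{1,j}$ ($j\in\mathcal{H}_1(x)$), $\eta_{2,j}$ ($j\in\mathcal{H}_2(x)$), $\nu_{1,j}$ ($j\in\mathcal{N}_1(x)$), $\nu_{2,j}$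 ($j\in\mathcal{N}_2(x)$) are $>0$; DISJ-ND3: $D^2L^{\text{D}(t)}(x)\restriction_{\mathcal{T}^{\text{D}(t)}_{x}}$ is nonsingular. For a nondegenerate C-stationary point of $\text{D}(t)$: $\text{DISJ-}QI$ is the number of negative eigenvalues of $D^2L^{\text{D}(t)}(x)\restriction_{\mathcal{T}^{\text{D}(t)}_{x}}$; $\text{DISJ-}BI$ is the number of $j\in\mathcal{H}_{12}(x)$ with $\zeta_{1,j}\ne 0,\zeta_{2,j}\neq 0$; $\text{DISJ-}CI=\text{DISJ-}QI+\text{DISJ-}BI$. *)

(* Defs.v *)
From mathcomp Require Export all_boot all_order all_algebra.
From mathcomp Require Export all_classical all_reals all_analysis.
From mathcomp Require Export polyrcf.

Set Implicit Arguments.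
Unset Strict Implicit.
Unset Printing Implicit Defensive.

Export Order.TTheory GRing.Theory Num.Theory.
Export numFieldNormedType.Exports.

Local Open Scope classical_set_scope.
Local Open Scope ring_scope.

Definition partial (R : realType) (n : nat) (i : 'I_n) (g : 'rV[R]_n -> R) :
    'rV[R]_n -> R :=
  fun x => 'D_(delta_mx 0 i) g x.

Definition has_partials (R : realType) (n : nat) (g : 'rV[R]_n -> R) : Prop :=
  forall (i : 'I_n) (x : 'rV[R]_n), derivable g x (delta_mx 0 i : 'rV[R]_n).

(* All partial derivatives of order 0, 1 and 2 exist and are continuous. *)
Definition C2 (R : realType) (n : nat) (g : 'rV[R]_n -> R) : Prop :=
  [/\ continuous g,
      has_partials g /\ (forall i, continuous (partial i g)) &
      forall i, has_partials (partial i g) /\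
        (forall j, continuous (partial j (partial i g)))].

Definition grad (R : realType) (n : nat) (g : 'rV[R]_n -> R) (x : 'rV[R]_n) :
    'rV[R]_n :=
  \row_i partial i g x.

Definition hess (R : realType) (n : nat) (g : 'rV[R]_n -> R) (x : 'rV[R]_n) :
    'M[R]_n :=
  \matrix_(i, j) partial j (partial i g) x.

(* The data (f, F_1, F_2) shared by MPCC and its regularization; kap is the
   number of complementarity constraints. *)
Record data (R : realType) (n kap : nat) := Data {
  obj : 'rV[R]_n -> R;
  map1 : 'rV[R]_n -> 'rV[R]_kap;
  map2 : 'rV[R]_n -> 'rV[R]_kap }.

Definition F1 (R : realType) (n kap : nat) (P : data R n kap) (j : 'I_kap)
  (x : 'rV[R]_n) : R := map1 P x 0 j.

Definition F2 (R : realType) (n kap : nat) (P : data R n kap) (j : 'I_kap)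
  (x : 'rV[R]_n) : R := map2 P x 0 j.

Definition C2_data (R : realType) (n kap : nat) (P : data R n kap) : Prop :=
  [/\ C2 (obj P), forall j, C2 (F1 P j) & forall j, C2 (F2 P j)].

(* Linear independence, as families, of the gradients of F_{1,j}, j in J1,
   together with those of F_{2,j}, j in J2. *)
Definition grads_free (R : realType) (n kap : nat) (P : data R n kap)
    (J1 J2 : {set 'I_kap}) (x : 'rV[R]_n) : bool :=
  free ([seq grad (F1 P j) x | j in J1] ++ [seq grad (F2 P j) x | j in J2]).

(* Row space = the vectors orthogonal to the gradients of F_{1,j}, j in J1,
   and of F_{2,j}, j in J2. *)
Definition grads_orth (R : realType) (n kap : nat) (P : data R n kap)
    (J1 J2 : {set 'I_kap}) (x : 'rV[R]_n) : 'M[R]_n :=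
  ((\bigcap_(j in J1) kermx (grad (F1 P j) x)^T) :&:
   (\bigcap_(j in J2) kermx (grad (F2 P j) x)^T))%MS.

(* Matrix, in the basis row_base T of the row space of T, of the quadratic form
   of H restricted to that space. *)
Definition restr_form (R : realType) (n : nat) (H T : 'M[R]_n) :
    'M[R]_(\rank T) :=
  row_base T *m H *m (row_base T)^T.

(* Matrix, in the same basis, of the endomorphism of the row space of T which
   represents that form with respect to the standard inner product: its
   eigenvalues are those of the restricted form, whatever the basis.  The Gram
   matrix inverted here is always invertible. *)
Definition restr_op (R : realType) (n : nat) (H T : 'M[R]_n) :
    'M[R]_(\rank T) :=
  restr_form H T *m invmx (row_base T *m (row_base T)^T).

(* Number of negative eigenvalues, counted with multiplicity. *)
Definition neg_eigenvalues (R : realType) (r : nat) (A : 'M[R]_r) : nat :=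
  (\sum_(a <- rootsR (char_poly A) | (a < 0)%R) mup a (char_poly A))%N.

Definition mpcc_feasible (R : realType) (n kap : nat) (P : data R n kap)
    (x : 'rV[R]_n) : Prop :=
  forall j, [/\ F1 P j x * F2 P j x = 0, 0 <= F1 P j x & 0 <= F2 P j x].

Definition a01 (R : realType) (n kap : nat) (P : data R n kap)
    (x : 'rV[R]_n) : {set 'I_kap} :=
  [set j | (F1 P j x == 0) && (0 < F2 P j x)]%SET.

Definition a10 (R : realType) (n kap : nat) (P : data R n kap)
    (x : 'rV[R]_n) : {set 'I_kap} :=
  [set j | (0 < F1 P j x) && (F2 P j x == 0)]%SET.

Definition a00 (R : realType) (n kap : nat) (P : data R n kap)
    (x : 'rV[R]_n) : {set 'I_kap} :=
  [set j | (F1 P j x == 0) && (F2 P j x == 0)]%SET.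

(* Each multiplier is only ever used on its own index set: sigma1 on a01,
   sigma2 on a10, rho1 and rho2 on a00. *)
Record mpcc_mult (R : realType) (kap : nat) := MpccMult {
  sigma1 : 'I_kap -> R;
  sigma2 : 'I_kap -> R;
  rho1 : 'I_kap -> R;
  rho2 : 'I_kap -> R }.

(* The Lagrange function, of the variable y, with index sets taken at x. *)
Definition mpcc_lagr (R : realType) (n kap : nat) (P : data R n kap)
    (x : 'rV[R]_n) (m : mpcc_mult R kap) (y : 'rV[R]_n) : R :=
  obj P y
  - \sum_(j in a01 P x) sigma1 m j * F1 P j y
  - \sum_(j in a10 P x) sigma2 m j * F2 P j y
  - \sum_(j in a00 P x) (rho1 m j * F1 P j y + rho2 m j * F2 P j y).

Definition mpcc_Cstationary (R : realType) (n kap : nat) (P : data R n kap)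
    (x : 'rV[R]_n) (m : mpcc_mult R kap) : Prop :=
  [/\ mpcc_feasible P x,
      grad (mpcc_lagr P x m) x = 0 &
      forall j, j \in a00 P x -> 0 <= rho1 m j * rho2 m j].

Definition mpcc_LICQ (R : realType) (n kap : nat) (P : data R n kap)
    (x : 'rV[R]_n) : bool :=
  grads_free P (a01 P x :|: a00 P x)%SET (a10 P x :|: a00 P x)%SET x.

Definition mpcc_tangent (R : realType) (n kap : nat) (P : data R n kap)
    (x : 'rV[R]_n) : 'M[R]_n :=
  grads_orth P (a01 P x :|: a00 P x)%SET (a10 P x :|: a00 P x)%SET x.

Definition mpcc_ND2 (R : realType) (n kap : nat) (P : data R n kap)
    (x : 'rV[R]_n) (m : mpcc_mult R kap) : Prop :=
  forall j, j \in a00 P x -> 0 < rho1 m j * rho2 m j.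

Definition mpcc_ND3 (R : realType) (n kap : nat) (P : data R n kap)
    (x : 'rV[R]_n) (m : mpcc_mult R kap) : Prop :=
  restr_form (hess (mpcc_lagr P x m) x) (mpcc_tangent P x) \in unitmx.

Definition mpcc_ND4 (R : realType) (n kap : nat) (P : data R n kap)
    (x : 'rV[R]_n) (m : mpcc_mult R kap) : Prop :=
  (forall j, j \in a01 P x -> sigma1 m j != 0) /\
  (forall j, j \in a10 P x -> sigma2 m j != 0).

Definition mpcc_nondegenerate (R : realType) (n kap : nat) (P : data R n kap)
    (x : 'rV[R]_n) (m : mpcc_mult R kap) : Prop :=
  [/\ mpcc_Cstationary P x m, mpcc_LICQ P x, mpcc_ND2 P x m & mpcc_ND3 P x m].

Definition mpcc_QI (R : realType) (n kap : nat) (P : data R n kap)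
    (x : 'rV[R]_n) (m : mpcc_mult R kap) : nat :=
  neg_eigenvalues (restr_op (hess (mpcc_lagr P x m) x) (mpcc_tangent P x)).

Definition mpcc_BI (R : realType) (n kap : nat) (P : data R n kap)
    (x : 'rV[R]_n) (m : mpcc_mult R kap) : nat :=
  #|[set j in a00 P x | (rho1 m j < 0) && (rho2 m j < 0)]%SET|.

Definition mpcc_CI (R : realType) (n kap : nat) (P : data R n kap)
    (x : 'rV[R]_n) (m : mpcc_mult R kap) : nat :=
  (mpcc_QI P x m + mpcc_BI P x m)%N.

Definition n_vanishing (R : realType) (n kap : nat) (P : data R n kap)
    (x : 'rV[R]_n) (m : mpcc_mult R kap) : nat :=
  (#|[set j in a01 P x | sigma1 m j == 0%R]%SET| +
   #|[set j in a10 P x | sigma2 m j == 0%R]%SET|)%N.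

Definition disj_feasible (R : realType) (n kap : nat) (P : data R n kap)
    (t : R) (x : 'rV[R]_n) : Prop :=
  forall j, [/\ 0 <= Num.max (t - F1 P j x) (t - F2 P j x),
                0 <= F1 P j x & 0 <= F2 P j x].

Definition H12 (R : realType) (n kap : nat) (P : data R n kap) (t : R)
    (x : 'rV[R]_n) : {set 'I_kap} :=
  [set j | (F1 P j x == t) && (F2 P j x == t)]%SET.

Definition H1 (R : realType) (n kap : nat) (P : data R n kap) (t : R)
    (x : 'rV[R]_n) : {set 'I_kap} :=
  [set j | (F1 P j x == t) && (t < F2 P j x)]%SET.

Definition H2 (R : realType) (n kap : nat) (P : data R n kap) (t : R)
    (x : 'rV[R]_n) : {set 'I_kap} :=
  [set j | (t < F1 P j x) && (F2 P j x == t)]%SET.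

Definition N1 (R : realType) (n kap : nat) (P : data R n kap)
    (x : 'rV[R]_n) : {set 'I_kap} :=
  [set j | F1 P j x == 0]%SET.

Definition N2 (R : realType) (n kap : nat) (P : data R n kap)
    (x : 'rV[R]_n) : {set 'I_kap} :=
  [set j | F2 P j x == 0]%SET.

(* As above: zeta1 and zeta2 are used on H12, eta1 on H1, eta2 on H2, nu1 on N1,
   nu2 on N2. *)
Record disj_mult (R : realType) (kap : nat) := DisjMult {
  zeta1 : 'I_kap -> R;
  zeta2 : 'I_kap -> R;
  eta1 : 'I_kap -> R;
  eta2 : 'I_kap -> R;
  nu1 : 'I_kap -> R;
  nu2 : 'I_kap -> R }.

(* The Lagrange function, of the variable y, with index sets taken at x. *)
Definition disj_lagr (R : realType) (n kap : nat) (P : data R n kap) (t : R)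
    (x : 'rV[R]_n) (m : disj_mult R kap) (y : 'rV[R]_n) : R :=
  obj P y
  - \sum_(j in H12 P t x)
      (zeta1 m j * (t - F1 P j y) + zeta2 m j * (t - F2 P j y))
  - \sum_(j in H1 P t x) eta1 m j * (t - F1 P j y)
  - \sum_(j in H2 P t x) eta2 m j * (t - F2 P j y)
  - \sum_(j in N1 P x) nu1 m j * F1 P j y
  - \sum_(j in N2 P x) nu2 m j * F2 P j y.

Definition disj_Cstationary (R : realType) (n kap : nat) (P : data R n kap)
    (t : R) (x : 'rV[R]_n) (m : disj_mult R kap) : Prop :=
  [/\ disj_feasible P t x,
      grad (disj_lagr P t x m) x = 0,
      forall j, j \in H12 P t x -> 0 <= zeta1 m j /\ 0 <= zeta2 m j,
      (forall j, j \in H1 P t x -> 0 <= eta1 m j) /\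
      (forall j, j \in H2 P t x -> 0 <= eta2 m j) &
      (forall j, j \in N1 P x -> 0 <= nu1 m j) /\
      (forall j, j \in N2 P x -> 0 <= nu2 m j)].

Definition disj_LICQ (R : realType) (n kap : nat) (P : data R n kap) (t : R)
    (x : 'rV[R]_n) : bool :=
  grads_free P (H12 P t x :|: H1 P t x :|: N1 P x)%SET
               (H12 P t x :|: H2 P t x :|: N2 P x)%SET x.

Definition disj_tangent (R : realType) (n kap : nat) (P : data R n kap) (t : R)
    (x : 'rV[R]_n) : 'M[R]_n :=
  grads_orth P (H12 P t x :|: H1 P t x :|: N1 P x)%SET
               (H12 P t x :|: H2 P t x :|: N2 P x)%SET x.

Definition disj_ND2 (R : realType) (n kap : nat) (P : data R n kap) (t : R)
    (x : 'rV[R]_n) (m : disj_mult R kap) : Prop :=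
  [/\ forall j, j \in H12 P t x -> 0 < zeta1 m j /\ 0 < zeta2 m j,
      forall j, j \in H1 P t x -> 0 < eta1 m j,
      forall j, j \in H2 P t x -> 0 < eta2 m j,
      forall j, j \in N1 P x -> 0 < nu1 m j &
      forall j, j \in N2 P x -> 0 < nu2 m j].

Definition disj_ND3 (R : realType) (n kap : nat) (P : data R n kap) (t : R)
    (x : 'rV[R]_n) (m : disj_mult R kap) : Prop :=
  restr_form (hess (disj_lagr P t x m) x) (disj_tangent P t x) \in unitmx.

Definition disj_nondegenerate (R : realType) (n kap : nat) (P : data R n kap)
    (t : R) (x : 'rV[R]_n) (m : disj_mult R kap) : Prop :=
  [/\ disj_Cstationary P t x m, disj_LICQ P t x, disj_ND2 P t x m &
      disj_ND3 P t x m].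

Definition disj_QI (R : realType) (n kap : nat) (P : data R n kap) (t : R)
    (x : 'rV[R]_n) (m : disj_mult R kap) : nat :=
  neg_eigenvalues (restr_op (hess (disj_lagr P t x m) x) (disj_tangent P t x)).

Definition disj_BI (R : realType) (n kap : nat) (P : data R n kap) (t : R)
    (x : 'rV[R]_n) (m : disj_mult R kap) : nat :=
  #|[set j in H12 P t x | (zeta1 m j != 0) && (zeta2 m j != 0)]%SET|.

Definition disj_CI (R : realType) (n kap : nat) (P : data R n kap) (t : R)
    (x : 'rV[R]_n) (m : disj_mult R kap) : nat :=
  (disj_QI P t x m + disj_BI P t x m)%N.

(* Main.v *)
(* MPCC-LICQ makes the gradients of the constraints active at xbar linearly
   independent near xbar. Since every constraint active for D(t) at x^t is
   eventually active at xbar, the multipliers of x^t, extended by 0 and counted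
   with a minus sign on H_12, H_1 and H_2, converge to those of xbar. Their signs
   on a_00 identify H_12(x^t) with the indices whose two multipliers at xbar are
   negative, and a constraint active at xbar can be inactive at x^t only if its
   multiplier at xbar vanishes, which happens at most s times.

   The number of negative eigenvalues of a restricted form is the dimension of
   the negative half of a splitting of the subspace into a negative definite and
   a positive definite part. A splitting of the tangent space at xbar can be
   moved into the kernel of the nearby gradients, hence into the tangent space of
   D(t) at x^t, where both parts remain definite. A negative definite and a
   positive definite subspace meet in 0; comparing dimensions, with the tangent
   space at x^t having at most s extra dimensions, gives both bounds on QI. *)
Require Import Defs.
From mathcomp Require Import ring lra zify.

Set Implicit Arguments.
Unset Strict Implicit.
Unset Printing Implicit Defensive.

Local Open Scope classical_set_scope.
Local Open Scope ring_scope.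

(** * Entrywise limits of matrices along a filter *)

Section MatrixConvergence.
Variables (R : realType) (T : Type) (F : set_system T).
Context {FF : Filter F}.

(** Taken entrywise, so that every matrix limit below reduces to limits of sums and products of
    scalars. *)
Definition mx_cvg (p q : nat) (M : T -> 'M[R]_(p, q)) (M0 : 'M[R]_(p, q)) :=
  forall i j, M x i j @[x --> F] --> M0 i j.

Lemma cvg_sumr (I : finType) (f : I -> T -> R) (l : I -> R) :
  (forall i, f i x @[x --> F] --> l i) ->
  \sum_i f i x @[x --> F] --> \sum_i l i.
Proof.
move=> fl; apply: (@cvg_big R I +%R 0 xpredT) => //.
by move=> x; exact: add_continuous.
Qed.

Lemma cvg_prodr (I : finType) (f : I -> T -> R) (l : I -> R) :
  (forall i, f i x @[x --> F] --> l i) ->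
  \prod_i f i x @[x --> F] --> \prod_i l i.
Proof.
move=> fl; apply: (@cvg_big R I *%R 1 xpredT) => //.
by move=> x; exact: mul_continuous.
Qed.

Lemma cvg_ext (u v : T -> R) (l l' : R) :
  v =1 u -> l' = l -> v x @[x --> F] --> l' -> u x @[x --> F] --> l.
Proof. by move=> /funext -> ->. Qed.

Lemma mx_cvg_cst p q (A : 'M[R]_(p, q)) : mx_cvg (fun=> A) A.
Proof. by move=> i j; exact: cvg_cst. Qed.

Lemma mx_cvg_mul p q r (M : T -> 'M[R]_(p, q)) (N : T -> 'M[R]_(q, r)) M0 N0 :
  mx_cvg M M0 -> mx_cvg N N0 -> mx_cvg (fun x => M x *m N x) (M0 *m N0).
Proof.
move=> cM cN i j; rewrite mxE (_ : (fun x => _) = (fun x => \sum_k M x i k * N x k j)).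
  by apply: cvg_sumr => k; apply: cvgM.
by apply/funext => x; rewrite mxE.
Qed.

Lemma mx_cvg_tr p q (M : T -> 'M[R]_(p, q)) M0 :
  mx_cvg M M0 -> mx_cvg (fun x => (M x)^T) M0^T.
Proof.
move=> cM i j; rewrite mxE (_ : (fun x => _) = (fun x => M x j i)) //.
by apply/funext => x; rewrite mxE.
Qed.

Lemma mx_cvgB p q (M N : T -> 'M[R]_(p, q)) M0 N0 :
  mx_cvg M M0 -> mx_cvg N N0 -> mx_cvg (fun x => M x - N x) (M0 - N0).
Proof.
move=> cM cN i j; rewrite !mxE (_ : (fun x => _) = (fun x => M x i j - N x i j)).
  exact: cvgB.
by apply/funext => x; rewrite !mxE.
Qed.

Lemma cvg_det p (M : T -> 'M[R]_p) M0 :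
  mx_cvg M M0 -> \det (M x) @[x --> F] --> \det M0.
Proof.
move=> cM; apply: cvg_sumr => s; apply: cvgM; first exact: cvg_cst.
by apply: cvg_prodr => i; exact: cM.
Qed.

Lemma near_unitmx p (M : T -> 'M[R]_p) M0 :
  mx_cvg M M0 -> M0 \in unitmx -> \forall x \near F, M x \in unitmx.
Proof.
move=> /cvg_det cd; rewrite unitmxE unitfE => d0.
have nz : \forall x \near F, \det (M x) != 0 by exact: cvgr_neq0 cd d0.
by apply: filterS nz => x; rewrite unitmxE unitfE.
Qed.

Lemma mx_cvg_inv p (M : T -> 'M[R]_p) M0 :
  mx_cvg M M0 -> M0 \in unitmx -> mx_cvg (fun x => invmx (M x)) (invmx M0).
Proof.
move=> cM uM0 i j.
(* The adjugate formula. [invmx] returns its argument on singular matrices, so the formula describes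
   [invmx (M x)] only eventually along the filter. *)
have cadj : ((\det (M x))^-1 * (\adj (M x)) i j) @[x --> F] --> invmx M0 i j.
  rewrite /invmx uM0 !mxE; apply: cvgM.
    by apply: cvgV; [rewrite -unitfE -unitmxE | exact: cvg_det].
  rewrite (_ : (fun x => _) = (fun x => cofactor (M x) j i)); last first.
    by apply/funext => x; rewrite mxE.
  apply: cvgM; first exact: cvg_cst.
  apply: cvg_det => k l; rewrite !mxE.
  rewrite (_ : (fun x => _) = (fun x => M x (lift j k) (lift i l))) //.
  by apply/funext => x; rewrite !mxE.
apply: cvg_trans cadj; apply: near_eq_cvg.
by apply: filterS (near_unitmx cM uM0) => x ux; rewrite [in RHS]/invmx ux !mxE.
Qed.

End MatrixConvergence.

(** * Quadratic forms on a subspace and their orthonormal diagonalization *)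

Section LinearAlgebra.
Variable R : realType.

Definition dotv (n : nat) (u v : 'rV[R]_n) : R := (u *m v^T) 0 0.

Definition bilin (n : nat) (H : 'M[R]_n) (u v : 'rV[R]_n) : R :=
  (u *m H *m v^T) 0 0.

Lemma dotvE n (u v : 'rV[R]_n) : dotv u v = bilin 1%:M u v.
Proof. by rewrite /bilin mulmx1. Qed.

Lemma bilinDl n (H : 'M[R]_n) u1 u2 v :
  bilin H (u1 + u2) v = bilin H u1 v + bilin H u2 v.
Proof. by rewrite /bilin !mulmxDl mxE. Qed.

Lemma bilinDr n (H : 'M[R]_n) u v1 v2 :
  bilin H u (v1 + v2) = bilin H u v1 + bilin H u v2.
Proof. by rewrite /bilin linearD /= mulmxDr mxE. Qed.

Lemma bilinZl n (H : 'M[R]_n) a u v : bilin H (a *: u) v = a * bilin H u v.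
Proof. by rewrite /bilin -!scalemxAl mxE. Qed.

Lemma bilinZr n (H : 'M[R]_n) a u v : bilin H u (a *: v) = a * bilin H u v.
Proof. by rewrite /bilin linearZ /= -scalemxAr mxE. Qed.

Lemma bilinC n (H : 'M[R]_n) u v : H^T = H -> bilin H u v = bilin H v u.
Proof.
move=> HT; rewrite /bilin.
have -> : v *m H *m u^T = (u *m H *m v^T)^T by rewrite !trmx_mul trmxK HT mulmxA.
by rewrite [RHS]mxE.
Qed.

Lemma dotv_sum n (u : 'rV[R]_n) : dotv u u = \sum_i u 0 i ^+ 2.
Proof. by rewrite /dotv mxE; apply: eq_bigr => i _; rewrite mxE expr2. Qed.

Lemma dotv_ge0 n (u : 'rV[R]_n) : 0 <= dotv u u.
Proof. by rewrite dotv_sum sumr_ge0 // => i _; rewrite sqr_ge0. Qed.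

Lemma dotv_gt0 n (u : 'rV[R]_n) : u != 0 -> 0 < dotv u u.
Proof.
move=> u0; rewrite lt_def dotv_ge0 andbT; apply: contraNneq u0 => u0.
apply/eqP/rowP => i; rewrite mxE.
have /eqP := u0; rewrite dotv_sum psumr_eq0 => [|j _]; last exact: sqr_ge0.
by move=> /allP/(_ i (mem_index_enum _)); rewrite /= sqrf_eq0 => /eqP.
Qed.

Lemma continuous_bilin n (H : 'M[R]_n) : continuous (fun u => bilin H u u).
Proof.
move=> u; apply: (@mx_cvg_mul R _ (nbhs u) _ 1 n 1 (fun u => u *m H) (fun u => u^T)).
  apply: mx_cvg_mul; last exact: mx_cvg_cst.
  by move=> i j; exact: coord_continuous.
by apply: mx_cvg_tr => i j; exact: coord_continuous.
Qed.

(** Heine-Borel: each squared coordinate is at most [dotv u u], and lying in the row space of [T] is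
    the closed condition that [u *m cokermx T] vanishes. *)
Lemma compact_unit_sphere_sub n p (T : 'M[R]_(p, n)) :
  compact [set u : 'rV[R]_n | (u <= T)%MS /\ dotv u u = 1].
Proof.
apply: bounded_closed_compact.
- exists 1; split => // M M1 u /= [_ u1].
  rewrite [`|u|]mx_normrE; apply/bigmax_leP; split => [|[i j] _ /=]; first lra.
  rewrite ord1 -(@ler_pXn2r _ 2) ?nnegrE //; last lra.
  rewrite real_normK ?num_real //.
  have : u 0 j ^+ 2 <= dotv u u.
    by rewrite dotv_sum (bigD1 j) //= lerDl sumr_ge0 // => k _; exact: sqr_ge0.
  by rewrite u1; nra.
- have -> : [set u : 'rV[R]_n | (u <= T)%MS /\ dotv u u = 1] =
      (\bigcap_(j in [set: 'I_n])
        ((fun u : 'rV[R]_n => (u *m cokermx T) 0 j) @^-1` [set 0]))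
      `&` ((fun u => dotv u u) @^-1` [set 1]).
    apply/seteqP; split => u /=.
      by rewrite submxE => -[/eqP uT ->]; split => // j _; rewrite /= uT mxE.
    move=> [uT u1]; split => //; rewrite submxE; apply/eqP/rowP => j.
    by rewrite (uT j I) mxE.
  apply: closedI.
    apply: closed_bigI => j _; apply: preimage_closed => [u _|]; last exact: closed_eq.
    apply: (@mx_cvg_mul R _ (nbhs u) _ 1 n n id); last exact: mx_cvg_cst.
    by move=> ? ?; exact: coord_continuous.
  apply: preimage_closed => [u _|]; last exact: closed_eq.
  rewrite (_ : (fun u => _) = (fun u => bilin 1%:M u u)); first exact: continuous_bilin.
  by apply/funext => v; rewrite dotvE.
Qed.

(* [v] maximises the Rayleigh quotient of [H] on the row space of [T]. *)
Lemma exists_restricted_eigenvector n p (H : 'M[R]_n) (T : 'M[R]_(p, n)) :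
  H^T = H -> T != 0 ->
  exists v : 'rV[R]_n, [/\ (v <= T)%MS, dotv v v = 1 &
    forall w, (w <= T)%MS -> dotv v w = 0 -> bilin H v w = 0].
Proof.
move=> HT T0; set A := [set u : 'rV[R]_n | (u <= T)%MS /\ dotv u u = 1].
have A0 : A !=set0.
  have /rowV0Pn[v vT v0] := T0.
  have d0 := dotv_gt0 v0.
  exists ((Num.sqrt (dotv v v))^-1 *: v); split; first exact: scalemx_sub.
  rewrite dotvE bilinZl bilinZr -dotvE mulrA -invfM -expr2 sqr_sqrtr ?(ltW d0) //.
  by rewrite mulVf // gt_eqF.
have [v /set_mem[vT v1] vmax] := EVT_max_rV A0 (@compact_unit_sphere_sub n p T)
  (continuous_subspaceT (@continuous_bilin _ H)).
exists v; split => // w wT vw.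
(* Homogeneity extends the bound from unit vectors to the whole row space. *)
have maxhom u : (u <= T)%MS -> bilin H u u <= bilin H v v * dotv u u.
  move=> uT; have [->|u0] := eqVneq u 0.
    by rewrite -(scale0r v) dotvE !bilinZl !mul0r mulr0.
  have d0 := dotv_gt0 u0.
  have := vmax ((Num.sqrt (dotv u u))^-1 *: u).
  rewrite bilinZl bilinZr mulrA -invfM -expr2 sqr_sqrtr ?(ltW d0) //.
  rewrite ler_pdivrMl // mulrC; apply; apply/mem_set; split.
    exact: scalemx_sub.
  rewrite dotvE bilinZl bilinZr -dotvE mulrA -invfM -expr2 sqr_sqrtr ?(ltW d0) //.
  by rewrite mulVf // gt_eqF.
(* First-order condition along [v + s w]. *)
have foc s : 2 * s * bilin H v w <=
    s ^+ 2 * (bilin H v v * dotv w w - bilin H w w).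
  have := maxhom (v + s *: w) (addmx_sub vT (scalemx_sub s wT)).
  rewrite dotvE !(bilinDl, bilinDr, bilinZl, bilinZr) -!dotvE.
  rewrite (bilinC w v HT) [dotv w v]dotvE (bilinC w v (trmx1 _ _)) -dotvE vw v1.
  move: (bilin H v v) (bilin H v w) (bilin H w w) (dotv w w) => a b c d; nra.
move: foc; set b := bilin H v w; set K := _ - _ => foc.
(* With [s = b / D] and [K < D], the first-order condition reads [2 D s^2 <= K s^2], which forces
   [s = 0] and hence [b = 0]. *)
have := foc (b / (1 + `|K|)); set D := 1 + `|K|.
have D0 : 0 < D by rewrite ltr_pwDl.
have KD : K < D by rewrite (le_lt_trans (ler_norm K)) // ltrDr.
have -> : 2 * (b / D) * b = (2 * D) * (b / D) ^+ 2.
  by field; rewrite gt_eqF.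
move=> h; apply/eqP; have : (b / D) ^+ 2 <= 0.
  by move: (sqr_ge0 (b / D)) h; nra.
move=> h2; have : (b / D) ^+ 2 == 0 by rewrite eq_le h2 sqr_ge0.
by rewrite sqrf_eq0 mulf_eq0 invr_eq0 (gt_eqF D0) orbF.
Qed.

(** The spectral theorem for the compression of [H] to a subspace, by induction on the rank: split
    off a unit maximiser [v] of the Rayleigh quotient and diagonalize on its orthogonal complement
    [T'] inside [T]. *)
Lemma orthonormal_diagonalization n r p (H : 'M[R]_n) (T : 'M[R]_(p, n)) :
  H^T = H -> \rank T = r ->
  exists (Q : 'M[R]_(r, n)) (d : 'rV[R]_r),
    [/\ (Q :=: T)%MS, Q *m Q^T = 1%:M & Q *m H *m Q^T = diag_mx d].
Proof.
move=> HT; elim: r p T => [|r IH] p T rT.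
  exists 0, 0; split; try by apply/matrixP => -[].
  have /eqP -> : T == 0 by rewrite -mxrank_eq0 rT.
  by apply/eqmxP; rewrite !sub0mx.
have T0 : T != 0 by rewrite -mxrank_eq0 rT.
have [v [vT v1 vorth]] := exists_restricted_eigenvector HT T0.
pose T' := (T :&: kermx v^T)%MS.
have T'P (w : 'rV[R]_n) : (w <= T')%MS = (w <= T)%MS && (dotv v w == 0).
  rewrite sub_capmx; congr andb.
  rewrite dotvE bilinC ?trmx1 // -dotvE.
  apply/sub_kermxP/eqP => [e|e]; first by rewrite /dotv e mxE.
  by apply/matrixP => i j; rewrite !ord1 [RHS]mxE.
have v0 : v != 0.
  by apply: contra_eq_neq v1 => ->; rewrite /dotv mul0mx mxE eq_sym oner_eq0.
have decomp : (T <= v + T')%MS.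
  apply/rV_subP => w wT.
  have -> : w = dotv v w *: v + (w - dotv v w *: v) by rewrite addrC subrK.
  rewrite addmx_sub_adds ?scalemx_sub // T'P addmx_sub ?eqmx_opp ?scalemx_sub //=.
  rewrite -scaleNr dotvE bilinDr bilinZr -!dotvE v1; apply/eqP; ring.
have vT' : (v :&: T')%MS = 0.
  apply/eqP; rewrite -submx0; apply/rV_subP => w; rewrite sub_capmx.
  move=> /andP[/sub_rVP[a ->]]; rewrite T'P => /andP[_].
  by rewrite dotvE bilinZr -dotvE v1 mulr1 => /eqP ->; rewrite scale0r sub0mx.
have TE : (v + T' :=: T)%MS.
  by apply/eqmxP; rewrite addsmx_sub vT capmxSl decomp.
have rT' : \rank T' = r.
  by have := mxrank_disjoint_sum vT'; rewrite TE rT rank_rV v0 => -[->].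
have [Q [d [QT QQ QH]]] := IH _ T' rT'.
have Qv : Q *m v^T = 0.
  by apply/sub_kermxP; rewrite QT capmxSr.
have vQ : v *m Q^T = 0 by rewrite -[LHS]trmxK trmx_mul trmxK Qv trmx0.
(* The off-diagonal block vanishes because the rows of [Q] lie in [T] and are orthogonal to [v]. *)
have QHv : v *m H *m Q^T = 0.
  apply/rowP => i; rewrite [RHS]mxE -[LHS](_ : bilin H v (row i Q) = _).
    apply: vorth.
      by rewrite (submx_trans (row_sub i Q)) // QT capmxSl.
    have := congr1 (fun M : 'M[R]_(_, _) => M 0 i) vQ; rewrite [RHS]mxE => <-.
    by rewrite /dotv [LHS]mxE [RHS]mxE; apply: eq_bigr => k _; rewrite !mxE.
  by rewrite /bilin [LHS]mxE [RHS]mxE; apply: eq_bigr => k _; rewrite !mxE.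
have QHv' : Q *m H *m v^T = 0.
  have -> : Q *m H *m v^T = (v *m H *m Q^T)^T by rewrite !trmx_mul trmxK HT mulmxA.
  by rewrite QHv trmx0.
exists (col_mx v Q : 'M[R]_(1 + r, n)),
  (row_mx (v *m H *m v^T) d : 'rV[R]_(1 + r)); split.
- have QE : (col_mx v Q :=: v + T')%MS.
    by apply: eqmx_trans (eqmx_sym (addsmxE _ _)) (adds_eqmx (eqmx_refl v) QT).
  exact: eqmx_trans QE TE.
- suff: col_mx v Q *m (col_mx v Q)^T = 1%:M :> 'M[R]_(1 + r) by [].
  rewrite tr_col_mx mul_col_row vQ Qv QQ [RHS](@scalar_mx_block _ 1 r).
  by congr block_mx; apply/matrixP => i j; rewrite !ord1 [LHS]v1 mxE.
- suff: col_mx v Q *m H *m (col_mx v Q)^T =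
      diag_mx (row_mx (v *m H *m v^T) d) :> 'M[R]_(1 + r) by [].
  rewrite mul_col_mx tr_col_mx mul_col_row QHv QHv' QH.
  rewrite diag_mx_row; congr block_mx.
  by apply/matrixP => i j; rewrite !ord1 [RHS]mxE eqxx mulr1n.
Qed.

End LinearAlgebra.

(** * Symmetry of second derivatives, and derivatives of Lagrange functions *)

Section Derivatives.
Variables (R : realType) (n : nat).
Implicit Types (g : 'rV[R]_n -> R) (x v : 'rV[R]_n).

(** Turns a directional derivative into the derivative of a function of one real variable, to which
    the mean value theorem applies. *)
Lemma is_derive_line g x v s :
  derivable g (x + s *: v) v ->
  is_derive s 1 (fun s : R => g (x + s *: v)) ('D_v g (x + s *: v)).
Proof.
have E : (fun h : R => h^-1 *: (((fun s : R => g (x + s *: v)) \o shift s) (h *: 1) -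
      g (x + s *: v))) =
    (fun h => h^-1 *: ((g \o shift (x + s *: v)) (h *: v) - g (x + s *: v))).
  apply/funext => h /=; rewrite [h *: 1]mulr1 scalerDl.
  by rewrite addrCA.
move=> dg; split; first by rewrite /derivable E.
by rewrite /derive E.
Qed.

(** Two uses of the mean value theorem: first for [phi], the increment of [g] in direction [j], as
    its argument moves in direction [i]; then for [psi], the resulting partial derivative, in
    direction [j]. *)
Lemma mixed_difference g i j x (h : R) :
  C2 g -> 0 < h ->
  exists s r, [/\ 0 < s < h, 0 < r < h &
    g (x + h *: delta_mx 0 j + h *: delta_mx 0 i) - g (x + h *: delta_mx 0 i) -
      (g (x + h *: delta_mx 0 j) - g x) =
    h * h * partial j (partial i g) (x + s *: delta_mx 0 i + r *: delta_mx 0 j)].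
Proof.
move=> [_ [pg _] ppg] h0; set ei := delta_mx 0 i; set ej := delta_mx 0 j.
pose phi (s : R) := g (x + h *: ej + s *: ei) - g (x + s *: ei).
have dphi (s : R) : is_derive s (1 : R) phi
    (partial i g (x + h *: ej + s *: ei) - partial i g (x + s *: ei)).
  by apply: is_deriveB; apply: is_derive_line; exact: pg.
have cphi : {within `[0, h], continuous phi}.
  by apply: derivable_within_continuous => s _; have [] := dphi s.
have [s sI Es] := MVT h0 (fun s _ => dphi s) cphi.
pose psi (r : R) := partial i g (x + s *: ei + r *: ej).
have dpsi (r : R) : is_derive r (1 : R) psi (partial j (partial i g) (x + s *: ei + r *: ej)).
  by apply: is_derive_line; have [+ _] := ppg i; apply.
have cpsi : {within `[0, h], continuous psi}.
  by apply: derivable_within_continuous => r _; have [] := dpsi r.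
have [r rI Er] := MVT h0 (fun r _ => dpsi r) cpsi.
exists s, r; split; [by move: sI; rewrite in_itv | by move: rI; rewrite in_itv |].
move: Es Er; rewrite /phi /psi !scale0r !addr0 !subr0 => ->.
by rewrite (addrAC x) => ->; ring.
Qed.

(** Schwarz's theorem. The second difference is symmetric in [i] and [j], so the two mixed partials
    take a common value at two points near [x]; continuity brings both values at [x] within [e / 2]
    of it. *)
Lemma partialC g i j x :
  C2 g -> partial j (partial i g) x = partial i (partial j g) x.
Proof.
move=> gC2; have [_ _ ppg] := gC2.
apply/eqP; rewrite -subr_eq0 -normr_eq0 eq_le normr_ge0 andbT.
apply/ler_addgt0Pr => e e0; rewrite add0r.
have e20 : 0 < e / 2 by rewrite divr_gt0.
have [_ /(_ j x) ci] := ppg i; have [_ /(_ i x) cj] := ppg j.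
have /cvgrPdist_lt/(_ _ e20)/nbhs_ballP[d1 /= d10 H1] := ci.
have /cvgrPdist_lt/(_ _ e20)/nbhs_ballP[d2 /= d20 H2] := cj.
set ei : 'rV[R]_n := delta_mx 0 i; set ej : 'rV[R]_n := delta_mx 0 j.
pose N := 1 + `|ei| + `|ej|.
have N0 : 0 < N by rewrite /N -addrA ltr_pwDl // addr_ge0.
(* Small enough that both intermediate points fall in the balls of radii [d1] and [d2]; the summand
   1 in [N] keeps the division legitimate and the inequality strict. *)
pose h := Num.min d1 d2 / N.
have h0 : 0 < h by rewrite divr_gt0 // lt_min d10.
have hN : h * N = Num.min d1 d2 by rewrite /h mulfVK // gt_eqF.
have close (d s r : R) (u v : 'rV[R]_n) : `|u| + `|v| <= `|ei| + `|ej| ->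
    Num.min d1 d2 <= d -> 0 < s < h -> 0 < r < h -> ball x d (x + s *: u + r *: v).
  move=> uv dd /andP[s0 sh] /andP[r0 rh].
  rewrite -ball_normE /ball_ /= -addrA opprD addNKr normrN.
  rewrite (le_lt_trans (ler_normD _ _)) // !normrZ !gtr0_norm //.
  apply: lt_le_trans dd; rewrite -hN /N.
  move: (normr_ge0 u) (normr_ge0 v) uv; move: `|u| `|v| `|ei| `|ej| => a b c D; nra.
have m1 : Num.min d1 d2 <= d1 by rewrite ge_min lexx.
have m2 : Num.min d1 d2 <= d2 by rewrite ge_min lexx orbT.
have [s [r [sh rh E1]]] := mixed_difference i j x gC2 h0.
have [s' [r' [sh' rh' E2]]] := mixed_difference j i x gC2 h0.
have E : partial j (partial i g) (x + s *: ei + r *: ej) =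
    partial i (partial j g) (x + s' *: ej + r' *: ei).
  have hh : h * h != 0 by rewrite mulf_neq0 // gt_eqF.
  apply: (mulfI hh); apply: etrans (esym E1) _; apply: etrans _ E2.
  by rewrite (addrAC x) opprB opprB addrACA [RHS]addrACA [- _ - _]addrC.
have l1 := H1 _ (close d1 s r ei ej (lexx _) m1 sh rh).
have uv : `|ej| + `|ei| <= `|ei| + `|ej| by rewrite addrC.
have l2 := H2 _ (close d2 s' r' ej ei uv m2 sh' rh').
rewrite /= in l1 l2; rewrite E in l1.
set c := partial i (partial j g) (x + s' *: ej + r' *: ei) in l1 l2.
move: (partial j (partial i g) x) (partial i (partial j g) x) c l1 l2 => a b c l1 l2.
have -> : a - b = (a - c) + (c - b) by rewrite addrA subrK.
apply: le_trans (ler_normD _ _) _; rewrite (distrC c).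
by rewrite [leRHS]splitr lerD ?(ltW l1) ?(ltW l2).
Qed.

Lemma hess_sym g x : C2 g -> (hess g x)^T = hess g x.
Proof. by move=> gC2; apply/matrixP => i j; rewrite !mxE partialC. Qed.

(** The common shape of both Lagrange functions. The terms of D(t) in which [t] multiplies a
    multiplier go into the constant [c], which derivatives do not see. *)
Definition lagr (I : finType) (f : 'rV[R]_n -> R) (g : I -> 'rV[R]_n -> R)
    (lam : I -> R) (c : R) (y : 'rV[R]_n) : R :=
  f y - \sum_i lam i * g i y + c.

Lemma is_derive_fsum (I : Type) (r : seq I) (h : I -> 'rV[R]_n -> R) (dh : I -> R) x v :
  (forall i, is_derive x v (h i) (dh i)) ->
  is_derive x v (fun y => \sum_(i <- r) h i y) (\sum_(i <- r) dh i).
Proof.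
move=> hd; elim: r => [|i r IH].
  have -> : (fun y : 'rV[R]_n => \sum_(i <- [::]) h i y) = cst 0.
    by apply/funext => y; rewrite big_nil.
  by rewrite big_nil; exact: (@is_derive_cst R 'rV[R]_n R 0 x v).
have -> : (fun y => \sum_(j <- i :: r) h j y) = h i + (fun y => \sum_(j <- r) h j y).
  by apply/funext => y; rewrite big_cons.
by rewrite big_cons; exact: is_deriveD.
Qed.

Lemma is_derive_lagr (I : finType) f (g : I -> 'rV[R]_n -> R) lam c x v :
  derivable f x v -> (forall i, derivable (g i) x v) ->
  is_derive x v (lagr f g lam c) (lagr ('D_v f) (fun i => 'D_v (g i)) lam 0 x).
Proof.
move=> df dg.
have -> : lagr f g lam c = (f - (fun y => \sum_i lam i * g i y)) + cst c by [].
apply: (is_deriveD _ (is_derive_cst c x v)); apply: (is_deriveB (derivableP df)).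
by apply: is_derive_fsum => i; exact: is_deriveZ (derivableP (dg i)).
Qed.

(** The result is again a [lagr], so the rule can be iterated to second order. *)
Lemma partial_lagr (I : finType) f (g : I -> 'rV[R]_n -> R) lam c i :
  has_partials f -> (forall k, has_partials (g k)) ->
  partial i (lagr f g lam c) = lagr (partial i f) (fun k => partial i (g k)) lam 0.
Proof.
move=> pf pg; apply/funext => x.
have d := is_derive_lagr lam c (pf i x) (fun k => pg k i x).
exact: derive_val.
Qed.

Lemma gradE g x i : grad g x 0 i = partial i g x.
Proof. exact: mxE. Qed.

Lemma hessE g x i j : hess g x i j = partial j (partial i g) x.
Proof. exact: mxE. Qed.

Lemma C2_lagr (I : finType) f (g : I -> 'rV[R]_n -> R) lam c :
  C2 f -> (forall k, C2 (g k)) -> C2 (lagr f g lam c).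
Proof.
move=> [cf [pf cpf] ppf] gC2.
have cl f' (g' : I -> _) c' : continuous f' -> (forall k, continuous (g' k)) ->
    continuous (lagr f' g' lam c').
  move=> cf' cg' x.
  have h : \sum_k lam k * g' k y @[y --> x] --> \sum_k lam k * g' k x.
    by apply: (@cvg_sumr R _ (nbhs x)) => k; exact: cvgM (cvg_cst _) (cg' k x).
  exact: cvgD (cvgB (cf' x) h) (cvg_cst c').
have pl f' (g' : I -> _) c' : has_partials f' -> (forall k, has_partials (g' k)) ->
    has_partials (lagr f' g' lam c').
  by move=> pf' pg' i x; have [] :=
    is_derive_lagr lam c' (pf' i x) (fun k => pg' k i x).
have pg k : has_partials (g k) by have [_ []] := gC2 k.
have pE i := partial_lagr lam c i pf pg.
split; first by apply: cl => // k; have [? _ _] := gC2 k.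
  split; first exact: pl.
  by move=> i; rewrite pE; apply: cl => // k; have [_ []] := gC2 k.
move=> i; have [ppfi cppf] := ppf i.
have ppg k : has_partials (partial i (g k)) by have [_ _ /(_ i)[]] := gC2 k.
rewrite pE; split; first exact: pl.
move=> j; rewrite partial_lagr //; apply: cl => // k.
by have [_ _ /(_ i)[]] := gC2 k.
Qed.

Lemma grad_lagr (I : finType) f (g : I -> 'rV[R]_n -> R) lam c x :
  C2 f -> (forall k, C2 (g k)) ->
  grad (lagr f g lam c) x = grad f x - \sum_k lam k *: grad (g k) x.
Proof.
move=> [_ [pf _] _] gC2; apply/rowP => i.
have pg k : has_partials (g k) by have [_ []] := gC2 k.
rewrite [LHS]gradE (partial_lagr lam c i pf pg) /lagr addr0.
rewrite [RHS]mxE gradE [X in _ = _ + X]mxE summxE; congr (_ - _).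
by apply: eq_bigr => k _; rewrite [RHS]mxE gradE.
Qed.

Lemma hess_lagr (I : finType) f (g : I -> 'rV[R]_n -> R) lam c x i j :
  C2 f -> (forall k, C2 (g k)) ->
  hess (lagr f g lam c) x i j = hess f x i j - \sum_k lam k * hess (g k) x i j.
Proof.
move=> [_ [pf _] ppf] gC2.
have pg k : has_partials (g k) by have [_ []] := gC2 k.
rewrite [LHS]hessE (partial_lagr lam c i pf pg) partial_lagr; last 2 first.
- by have [] := ppf i.
- by move=> k; have [_ _ /(_ i)[]] := gC2 k.
rewrite /lagr addr0; apply: (f_equal2 (fun a b => a - b)); first exact/esym/hessE.
by apply: eq_bigr => k _; apply: (f_equal2 *%R) => //; exact/esym/hessE.
Qed.

Lemma cvg_grad (T : Type) (F : set_system T) {FF : Filter F} g (y : T -> 'rV[R]_n) x :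
  C2 g -> y @ F --> x -> mx_cvg F (fun k => grad g (y k)) (grad g x).
Proof.
move=> [_ [_ cg] _] yx i j; rewrite [i]ord1 gradE.
rewrite (_ : (fun k => _) = (fun k => partial j g (y k))).
  by apply: continuous_cvg => //; exact: cg.
by apply/funext => k; exact: gradE.
Qed.

Lemma cvg_hess (T : Type) (F : set_system T) {FF : Filter F} g (y : T -> 'rV[R]_n) x :
  C2 g -> y @ F --> x -> mx_cvg F (fun k => hess g (y k)) (hess g x).
Proof.
move=> [_ _ cg] yx i j.
apply: (@cvg_ext _ _ F _ (fun k => partial j (partial i g) (y k)) _
  (partial j (partial i g) x)) => [k||].
- exact/esym/hessE.
- exact/esym/hessE.
- by apply: continuous_cvg => //; have [_] := cg i; apply.
Qed.

End Derivatives.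

(** * Negative eigenvalues as dimensions of definite subspaces *)

Section Index.
Variable R : realType.

(** Vacuous for [p = 0], so that one half of a splitting may be trivial. *)
Definition posdef (p : nat) (M : 'M[R]_p) : Prop :=
  forall u : 'rV[R]_p, u != 0 -> 0 < bilin M u u.

Lemma bilin_congr p n (H : 'M[R]_n) (X : 'M[R]_(p, n)) u v :
  bilin (X *m H *m X^T) u v = bilin H (u *m X) (v *m X).
Proof. by rewrite /bilin trmx_mul !mulmxA. Qed.

Lemma bilinN n (H : 'M[R]_n) u v : bilin (- H) u v = - bilin H u v.
Proof. by rewrite /bilin mulmxN mulNmx mxE. Qed.

Lemma bilinB n (H K : 'M[R]_n) u v : bilin (H - K) u v = bilin H u v - bilin K u v.
Proof. by rewrite /bilin mulmxBr mulmxBl !mxE. Qed.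

Lemma bilin_sum n (H : 'M[R]_n) u v :
  bilin H u v = \sum_j \sum_i u 0 i * H i j * v 0 j.
Proof. by rewrite /bilin mxE; apply: eq_bigr => j _; rewrite !mxE mulr_suml. Qed.

Lemma posdef_ge0 p (M : 'M[R]_p) u : posdef M -> 0 <= bilin M u u.
Proof.
move=> Mp; have [->|/Mp/ltW//] := eqVneq u 0.
by rewrite /bilin !mul0mx mxE.
Qed.

Lemma posdef_diag p (d : 'rV[R]_p) : (forall i, 0 < d 0 i) -> posdef (diag_mx d).
Proof.
move=> d0 u u0.
have E : bilin (diag_mx d) u u = \sum_i d 0 i * u 0 i ^+ 2.
  rewrite bilin_sum; apply: eq_bigr => j _.
  rewrite (bigD1 j) //= big1 ?addr0 => [|i ij].
    by rewrite mxE eqxx mulr1n; ring.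
  by rewrite mxE (negPf ij) mulr0n mulr0 mul0r.
have ge0 i : 0 <= d 0 i * u 0 i ^+ 2 by rewrite mulr_ge0 ?sqr_ge0 ?ltW.
rewrite E lt_def sumr_ge0 // andbT; apply: contraNneq u0 => /eqP.
rewrite psumr_eq0 // => /allP h; apply/eqP/rowP => i; rewrite mxE.
have := h i (mem_index_enum _).
by rewrite mulf_eq0 gt_eqF //= sqrf_eq0 => /eqP.
Qed.

(** On the compact unit sphere the limit form has a positive minimum. Unit vectors have coordinates
    of modulus at most 1, so there the forms differ by at most the sum of the entrywise distances,
    which tends to 0. *)
Lemma near_posdef (T : Type) (F : set_system T) {FF : Filter F} p
    (M_ : T -> 'M[R]_p) M :
  mx_cvg F M_ M -> posdef M -> \forall k \near F, posdef (M_ k).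
Proof.
move=> cM Mp; set A := [set u : 'rV[R]_p | (u <= 1%:M)%MS /\ dotv u u = 1].
have unitA (u : 'rV[R]_p) : u != 0 -> A ((Num.sqrt (dotv u u))^-1 *: u).
  move=> u0; split; first exact: submx1.
  rewrite dotvE bilinZl bilinZr -dotvE mulrA -invfM -expr2.
  by rewrite sqr_sqrtr ?dotv_ge0 // mulVf // gt_eqF ?dotv_gt0.
(* Without unit vectors there is no nonzero vector either, and positivity is vacuous. *)
have [A0|A0] := pselect (A !=set0); last first.
  by apply: filterE => k u /unitA uA; case: A0; exists ((Num.sqrt (dotv u u))^-1 *: u).
have [v /set_mem[_ v1] vmin] := EVT_min_rV A0 (@compact_unit_sphere_sub R p p 1%:M)
  (continuous_subspaceT (@continuous_bilin _ _ M)).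
have c0 : 0 < bilin M v v.
  by apply: Mp; apply: contra_eq_neq v1 => ->; rewrite /dotv mul0mx mxE eq_sym oner_eq0.
have cE : \sum_j \sum_i `|M i j - M_ k i j| @[k --> F] --> (0 : R).
  rewrite [X in _ --> X](_ : _ = \sum_(j : 'I_p) \sum_(i : 'I_p) 0); last by rewrite !big1.
  apply: cvg_sumr => j; apply: cvg_sumr => i.
  rewrite -[X in _ --> X](normr0 R) -(subrr (M i j)); apply: cvg_norm.
  exact: cvgB (cvg_cst _) (cM i j).
have ne : \forall k \near F, \sum_j \sum_i `|M i j - M_ k i j| < bilin M v v.
  exact: cvgr_lt cE _ c0.
apply: filterS ne => k Ek u u0.
have [_ w1] := unitA u u0; set w := _ *: u in w1.
have wA : w \in A by apply/mem_set; split => //; exact: submx1.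
have wle i : `|w 0 i| <= 1.
  rewrite -(@ler_pXn2r _ 2) ?nnegrE // real_normK ?num_real // expr1n -w1 dotv_sum.
  by rewrite (bigD1 i) //= lerDl sumr_ge0 // => l _; exact: sqr_ge0.
have wpos : 0 < bilin (M_ k) w w.
  have : `|bilin (M - M_ k) w w| <= \sum_j \sum_i `|M i j - M_ k i j|.
    rewrite bilin_sum (le_trans (ler_norm_sum _ _ _)) // ler_sum // => j _.
    rewrite (le_trans (ler_norm_sum _ _ _)) // ler_sum // => i _.
    have -> : (M - M_ k) i j = M i j - M_ k i j by rewrite !mxE.
    rewrite !normrM mulrAC ler_piMl ?normr_ge0 //.
    by rewrite mulr_ile1 ?normr_ge0 ?wle.
  have := vmin w wA; rewrite bilinB.
  have := ler_norm (bilin M w w - bilin (M_ k) w w).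
  move: Ek; lra.
move: wpos; rewrite /w bilinZl bilinZr !pmulr_rgt0 ?invr_gt0 ?sqrtr_gt0 ?dotv_gt0 //.
Qed.

(** A relation between the rows of [N] and those of [P] equates a combination of the former with one
    of the latter. The form would be negative on the first and nonnegative on the second, so both
    sets of coefficients vanish, and the stacked rows are independent inside [T]. *)
Lemma definite_rank_bound a p q n (H : 'M[R]_n) (N : 'M[R]_(a, n)) (P : 'M[R]_(p, n))
    (T : 'M[R]_(q, n)) :
  posdef (- (N *m H *m N^T)) -> posdef (P *m H *m P^T) ->
  (N <= T)%MS -> (P <= T)%MS -> (a + p <= \rank T)%N.
Proof.
move=> Nneg Ppos NT PT.
suff /eqP <- : row_free (col_mx N P) by rewrite mxrankS // col_mx_sub NT.
apply: inj_row_free => u; rewrite -[u]hsubmxK mul_row_col.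
move: (lsubmx u) (rsubmx u) => u1 u2 /eqP; rewrite addr_eq0 => /eqP E.
have E1 : bilin (N *m H *m N^T) u1 u1 = bilin (P *m H *m P^T) u2 u2.
  by rewrite !bilin_congr E -scaleN1r bilinZl bilinZr; ring.
have u10 : u1 = 0.
  apply/eqP/negPn/negP => /Nneg; rewrite bilinN E1 oppr_gt0 ltNge.
  by rewrite posdef_ge0.
have u20 : u2 = 0.
  apply/eqP/negPn/negP => /Ppos; rewrite -E1 u10 /bilin !mul0mx mxE ltxx //.
by rewrite u10 u20 row_mx0.
Qed.

(** Serves to turn a sum of multiplicities over the distinct roots into a count along the list of
    diagonal entries. *)
Lemma sum_count_mem (I : eqType) (r s : seq I) (Q : pred I) :
  uniq r -> {subset s <= r} ->
  (\sum_(a <- r | Q a) count_mem a s = count Q s)%N.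
Proof.
move=> ur; elim: s => [|x s IH] sr /=; first by rewrite big1.
rewrite big_split /= IH => [|y ys]; last by rewrite sr // inE ys orbT.
congr addn; have xr : x \in r by rewrite sr // mem_head.
rewrite big_mkcond (bigD1_seq x) //= eqxx big1 => [|y yx].
  by rewrite addn0; case: (Q x).
by rewrite eq_sym (negPf yx); case: ifP.
Qed.

(** Similar matrices share their characteristic polynomial, here the product of the
    ['X - (d 0 i)%:P], in which the multiplicity of a root is its number of occurrences in [d]. *)
Lemma neg_eigenvalues_similar r (A C : 'M[R]_r) (d : 'rV[R]_r) :
  C \in unitmx -> A = C *m diag_mx d *m invmx C ->
  neg_eigenvalues A = #|[set i | d 0 i < 0]%SET|.
Proof.
move=> uC ->.
have cpE : char_poly (C *m diag_mx d *m invmx C) =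
    \prod_(y <- [seq d 0 i | i : 'I_r]) ('X - y%:P).
  transitivity (char_poly (diag_mx d)); last first.
    rewrite char_poly_trig ?diag_mx_is_trig // big_map big_enum /=.
    by apply: eq_bigr => i _; rewrite mxE eqxx mulr1n.
  rewrite /char_poly /char_poly_mx.
  have -> : 'X%:M - map_mx polyC (C *m diag_mx d *m invmx C) =
      map_mx polyC C *m ('X%:M - map_mx polyC (diag_mx d)) *m map_mx polyC (invmx C).
    rewrite mulmxBr mulmxBl scalar_mxC -[X in _ = X - _]mulmxA -!map_mxM mulmxV //.
    by rewrite map_mx1 mulmx1.
  by rewrite !det_mulmx mulrAC -det_mulmx -map_mxM mulmxV // map_mx1 det1 mul1r.
have p0 : char_poly (C *m diag_mx d *m invmx C) != 0.
  exact: monic_neq0 (char_poly_monic _).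
rewrite /neg_eigenvalues; under eq_bigr do rewrite [in mup _ _]cpE mu_prod_XsubC.
rewrite sum_count_mem.
- rewrite count_map -sum1_count big_enum_cond /= cardsE -sum1_card.
  by apply: eq_bigl => i; rewrite unfold_in.
- exact: uniq_roots.
- move=> y ys; rewrite -(roots_on_rootsR p0) in_itv /= cpE root_prod_XsubC //.
Qed.

(** Diagonalize on [T] in an orthonormal basis [Q] and let [N] and [P] collect the rows with
    negative and with positive diagonal entry; nonsingularity rules out a zero entry. *)
Lemma signature_split n (H T : 'M[R]_n) :
  H^T = H -> restr_form H T \in unitmx ->
  exists a p (N : 'M[R]_(a, n)) (P : 'M[R]_(p, n)),
    [/\ neg_eigenvalues (restr_op H T) = a, (a + p = \rank T)%N,
        (N <= T)%MS /\ (P <= T)%MS,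
        posdef (- (N *m H *m N^T)) & posdef (P *m H *m P^T)].
Proof.
move=> HT uH; have [Q [d [QT QQ QH]]] := orthonormal_diagonalization HT (erefl (\rank T)).
(* [C] changes basis between [Q] and [row_base T]. The restricted form is [C D C^T] with [D] the
   diagonal matrix and the Gram matrix is [C C^T], so the operator [restr_op] is [C D C^-1]. *)
have /submxP[C CQ] : (row_base T <= Q)%MS by rewrite QT eq_row_base.
have uC : C \in unitmx.
  rewrite -row_free_unit -row_leq_rank (leq_trans _ (mxrankM_maxl C Q)) // -CQ.
  by rewrite eq_row_base.
have formE : restr_form H T = C *m diag_mx d *m C^T.
  by rewrite /restr_form CQ trmx_mul -QH !mulmxA.
have gramE : row_base T *m (row_base T)^T = C *m C^T.
  by rewrite CQ trmx_mul mulmxA -(mulmxA C) QQ mulmx1.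
have uG : C *m C^T \in unitmx by rewrite unitmx_mul uC unitmx_tr.
have opE : restr_op H T = C *m diag_mx d *m invmx C.
  rewrite /restr_op formE gramE -[RHS](mulmxK uG) -(mulmxA _ (invmx C)).
  by rewrite (mulmxA (invmx C)) mulVmx // mul1mx.
have d0 i : d 0 i != 0.
  move: uH; rewrite formE !unitmx_mul unitmx_tr uC andbT /= unitmxE unitfE det_diag.
  by move=> /prodf_neq0; apply.
pose rows (A : {set 'I_(\rank T)}) := rowsub (@enum_val _ (mem A)) Q.
have rowsE A : rows A *m H *m (rows A)^T = diag_mx (\row_i d 0 (@enum_val _ (mem A) i)).
  transitivity (mxsub (@enum_val _ (mem A)) (@enum_val _ (mem A)) (Q *m H *m Q^T)).
    apply/matrixP => i j; rewrite [LHS]mxE [RHS]mxE [RHS]mxE; apply: eq_bigr => k _.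
    by rewrite !mxE; congr (_ * _); apply: eq_bigr => l _; rewrite !mxE.
  by rewrite QH; apply/matrixP => i j; rewrite !mxE (inj_eq enum_val_inj).
have rowsT A : (rows A <= T)%MS.
  by rewrite -QT; apply/row_subP => i; rewrite row_rowsub row_sub.
pose A := [set i | d 0 i < 0]%SET.
exists #|A|, #|~: A|%SET, (rows A), (rows (~: A)%SET); split.
- exact: neg_eigenvalues_similar opE.
- by rewrite cardsC card_ord.
- by split; exact: rowsT.
- rewrite rowsE -linearN /=; apply: posdef_diag => i; rewrite !mxE oppr_gt0.
  by have := enum_valP i; rewrite inE.
- rewrite rowsE; apply: posdef_diag => i; rewrite mxE lt_def d0 leNgt.
  by have := enum_valP i; rewrite !inE.
Qed.

(** * Coefficients, kernels and indices under perturbation of a full-rank matrix *)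

Section Perturbation.
Variables (T : Type) (F : set_system T).
Context {FF : Filter F}.
Variables (n q : nat) (A_ : T -> 'M[R]_(q, n)) (A : 'M[R]_(q, n)).
Hypotheses (cA : mx_cvg F A_ A) (freeA : row_free A).

(** With [W] a right inverse of [A], the product [A_ k *m W] tends to the identity and is eventually
    invertible; multiplying by [W] and then by the inverse of that product recovers [c_ k]. *)
Lemma cvg_coefficients (c_ : T -> 'rV[R]_q) (c : 'rV[R]_q) :
  mx_cvg F (fun k => c_ k *m A_ k) (c *m A) -> mx_cvg F c_ c.
Proof.
have [W AW] := row_freeP freeA.
move=> cc i j.
have cAW : mx_cvg F (fun k => A_ k *m W) 1%:M.
  by rewrite -AW; apply: mx_cvg_mul => //; exact: mx_cvg_cst.
have nu : \forall k \near F, A_ k *m W \in unitmx.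
  exact: near_unitmx cAW (unitmx1 _ _).
have : mx_cvg F (fun k => c_ k *m A_ k *m W *m invmx (A_ k *m W))
    (c *m A *m W *m invmx 1%:M).
  apply: mx_cvg_mul; last exact: mx_cvg_inv cAW (unitmx1 _ _).
  by apply: mx_cvg_mul => //; exact: mx_cvg_cst.
rewrite invmx1 mulmx1 -mulmxA AW mulmx1 => /(_ i j) cl.
apply: cvg_trans cl; apply: near_eq_cvg.
by apply: filterS nu => k uk; rewrite -(mulmxA (c_ k)) mulmxK.
Qed.

Lemma cvg_kernel_lift p (X : 'M[R]_(p, n)) :
  X *m A^T = 0 ->
  exists2 X_ : T -> 'M[R]_(p, n), mx_cvg F X_ X &
    \forall k \near F, X_ k *m (A_ k)^T = 0.
Proof.
move=> XA; have [W AW] := row_freeP freeA.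
have WA : W^T *m A^T = 1%:M by rewrite -trmx_mul AW trmx1.
have cAt := mx_cvg_tr cA.
have cWA : mx_cvg F (fun k => W^T *m (A_ k)^T) 1%:M.
  by rewrite -WA; apply: mx_cvg_mul => //; exact: mx_cvg_cst.
(* Oblique projection of the rows of [X] onto the kernel of [(A_ k)^T] along the row space of [W^T];
   in the limit it fixes [X], since [X *m A^T = 0]. *)
exists (fun k => X - X *m (A_ k)^T *m invmx (W^T *m (A_ k)^T) *m W^T).
  have E : X = X - X *m A^T *m invmx 1%:M *m W^T by rewrite XA !mul0mx subr0.
  rewrite [X in mx_cvg _ _ X]E; apply: mx_cvgB; first exact: mx_cvg_cst.
  apply: mx_cvg_mul; last exact: mx_cvg_cst.
  apply: mx_cvg_mul; last exact: mx_cvg_inv cWA (unitmx1 _ _).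
  by apply: mx_cvg_mul => //; exact: mx_cvg_cst.
have nu : \forall k \near F, W^T *m (A_ k)^T \in unitmx.
  exact: near_unitmx cWA (unitmx1 _ _).
by apply: filterS nu => k uk; rewrite mulmxBl -!mulmxA mulVmx // mulmx1 subrr.
Qed.

Lemma near_index_bounds (H_ S_ : T -> 'M[R]_n) (H S : 'M[R]_n) (s : nat) :
  mx_cvg F H_ H -> H^T = H -> (forall k, (H_ k)^T = H_ k) ->
  (S <= kermx A^T)%MS -> restr_form H S \in unitmx ->
  (forall k, restr_form (H_ k) (S_ k) \in unitmx) ->
  (\forall k \near F, (kermx (A_ k)^T <= S_ k)%MS) ->
  (\forall k \near F, (\rank (S_ k) <= \rank S + s)%N) ->
  \forall k \near F,
    (neg_eigenvalues (restr_op H S) <= neg_eigenvalues (restr_op (H_ k) (S_ k))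
       <= neg_eigenvalues (restr_op H S) + s)%N.
Proof.
move=> cH HT H_T SA uS uS_ nker nrank.
have [a [p [N [P [-> ap [NS PS] Nneg Ppos]]]]] := signature_split HT uS.
have [N_ cN nN] := cvg_kernel_lift (sub_kermxP (submx_trans NS SA)).
have [P_ cP nP] := cvg_kernel_lift (sub_kermxP (submx_trans PS SA)).
have cform m (X_ : T -> 'M[R]_(m, n)) X : mx_cvg F X_ X ->
    mx_cvg F (fun k => X_ k *m H_ k *m (X_ k)^T) (X *m H *m X^T).
  by move=> cX; apply: mx_cvg_mul; [exact: mx_cvg_mul | exact: mx_cvg_tr].
have nNneg : \forall k \near F, posdef (- (N_ k *m H_ k *m (N_ k)^T)).
  have c : mx_cvg F (fun k => 0 - N_ k *m H_ k *m (N_ k)^T) (0 - N *m H *m N^T).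
    by apply: mx_cvgB; [exact: mx_cvg_cst | exact: cform].
  have n0 : \forall k \near F, posdef (0 - N_ k *m H_ k *m (N_ k)^T).
    by apply: near_posdef c _; rewrite sub0r.
  by apply: filterS n0 => k; rewrite sub0r.
have nPpos : \forall k \near F, posdef (P_ k *m H_ k *m (P_ k)^T).
  exact: near_posdef (cform _ _ _ cP) Ppos.
near=> k.
have [b [r [N' [P' [-> br [N'S P'S] N'neg P'pos]]]]] := signature_split (H_T k) (uS_ k).
have kS : (kermx (A_ k)^T <= S_ k)%MS by near: k.
have NkS : (N_ k <= S_ k)%MS.
  by apply: submx_trans kS; apply/sub_kermxP; near: k.
have PkS : (P_ k <= S_ k)%MS.
  by apply: submx_trans kS; apply/sub_kermxP; near: k.
have Nkneg : posdef (- (N_ k *m H_ k *m (N_ k)^T)) by near: k.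
have Pkpos : posdef (P_ k *m H_ k *m (P_ k)^T) by near: k.
have rk : (\rank (S_ k) <= \rank S + s)%N by near: k.
(* The moved negative half against the positive half at [k] gives [a + r <= b + r]; the negative
   half at [k] against the moved positive half gives [b + p <= a + p + s]. *)
have h1 := definite_rank_bound Nkneg P'pos NkS P'S.
have h2 := definite_rank_bound N'neg Pkpos N'S PkS.
apply/andP; split; first by rewrite -(leq_add2r r) br.
by rewrite -(leq_add2r p) (leq_trans h2) // (leq_trans rk) // -ap addnAC.
Unshelve. all: by end_near.
Qed.

End Perturbation.
End Index.

(** * Active constraints and multipliers of both problems in a common form *)

Section Problem.
Variables (R : realType) (n kap : nat) (P : data R n kap).
Implicit Types (J : {set 'I_kap}) (A : {set 'I_kap + 'I_kap}) (x u : 'rV[R]_n).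

(** One index type for both families: [inl] for F_1 and [inr] for F_2, so that gradients,
    multipliers and active sets are handled together. *)
Definition constr (i : 'I_kap + 'I_kap) : 'rV[R]_n -> R :=
  match i with inl j => F1 P j | inr j => F2 P j end.

Definition sumset J1 J2 : {set 'I_kap + 'I_kap} :=
  [set i | match i with inl j => j \in J1 | inr j => j \in J2 end]%SET.

Definition gradmx A x : 'M[R]_(#|A|, n) :=
  \matrix_(a, k) grad (constr (@enum_val _ (mem A) a)) x 0 k.

Lemma row_gradmx A x a : row a (gradmx A x) = grad (constr (@enum_val _ (mem A) a)) x.
Proof. by apply/rowP => k; rewrite !mxE. Qed.

Lemma kermx_gradmxP A x u :
  (u <= kermx (gradmx A x)^T)%MS <->
  (forall i, i \in A -> dotv u (grad (constr i) x) = 0).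
Proof.
have E a : (u *m (gradmx A x)^T) 0 a = dotv u (grad (constr (@enum_val _ (mem A) a)) x).
  by rewrite /dotv [LHS]mxE [RHS]mxE; apply: eq_bigr => k _; rewrite !mxE.
split=> [/sub_kermxP uA i iA|h].
  by rewrite -[i](enum_rankK_in iA iA) -E uA mxE.
by apply/sub_kermxP/rowP => a; rewrite E mxE h // enum_valP.
Qed.

Lemma dotv0P u v : reflect (dotv u v = 0) (u <= kermx v^T)%MS.
Proof.
apply: (iffP sub_kermxP) => [e|e]; first by rewrite /dotv e mxE.
by apply/matrixP => i j; rewrite !ord1 [RHS]mxE.
Qed.

Lemma grads_orthE J1 J2 x :
  (grads_orth P J1 J2 x :=: kermx (gradmx (sumset J1 J2) x)^T)%MS.
Proof.
apply/eqmxP/rV_eqP => u; rewrite sub_capmx.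
apply/andP/idP => [[/sub_bigcapmxP h1 /sub_bigcapmxP h2]|/kermx_gradmxP h].
  by apply/kermx_gradmxP => -[] j; rewrite inE => jJ; apply/dotv0P; [apply: h1|apply: h2].
by split; apply/sub_bigcapmxP => j jJ; apply/dotv0P;
  [apply: (h (inl j))|apply: (h (inr j))]; rewrite inE.
Qed.

(** Induction on the list: a nonzero coefficient at the head would put its vector in the span of the
    tail. *)
Lemma free_map_sum_eq0 (V : vectType R) (I : eqType) (v : I -> V) (s : seq I) (c : I -> R) :
  uniq s -> free (map v s) -> \sum_(i <- s) c i *: v i = 0 ->
  forall i, i \in s -> c i = 0.
Proof.
elim: s => // i0 s IH /= /andP[i0s us]; rewrite free_cons => /andP[vi0 fs].
rewrite big_cons => E.
have c0 : c i0 = 0.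
  apply/eqP; apply: contraNT vi0 => c0.
  have -> : v i0 = - (c i0)^-1 *: \sum_(i <- s) c i *: v i.
    apply: (scalerI c0); rewrite scalerA mulrN mulfV // scaleN1r.
    by apply/eqP; rewrite -addr_eq0 E.
  rewrite memvZ // big_seq memv_suml // => i iS.
  by rewrite memvZ // memv_span // map_f.
move=> i; rewrite inE => /predU1P[-> //|]; apply: IH => //.
by move: E; rewrite c0 scale0r add0r.
Qed.

Lemma grads_free_gradmx J1 J2 x :
  grads_free P J1 J2 x -> row_free (gradmx (sumset J1 J2) x).
Proof.
rewrite /grads_free => fr; apply: inj_row_free => u uE.
pose s : seq ('I_kap + 'I_kap) := map inl (enum J1) ++ map inr (enum J2).
have memS i : (i \in s) = (i \in sumset J1 J2).
  rewrite mem_cat inE; case: i => j.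
    rewrite mem_map ?mem_enum; last by move=> ? ? [].
    by rewrite [X in _ || X](_ : _ = false) ?orbF //; apply/mapP => -[].
  rewrite [X in X || _](_ : _ = false) /=; last by apply/mapP => -[].
  by rewrite mem_map ?mem_enum // => ? ? [].
have us : uniq s.
  rewrite cat_uniq !map_inj_uniq ?enum_uniq ?andbT /=; try by move=> ? ? [].
  by apply/hasPn => _ /mapP[j _ ->]; apply/mapP => -[].
have fs : free (map (fun i => grad (constr i) x) s).
  by rewrite map_cat -!map_comp.
(* Carries the coefficients from row numbers to constraint indices; enumeration is injective, so at
   most one term occurs. This bridges the different orders of the rows of [gradmx] and of the list
   in [grads_free]. *)
pose c i := \sum_(a | @enum_val _ (mem (sumset J1 J2)) a == i) u 0 a.
have cE a : c (@enum_val _ (mem (sumset J1 J2)) a) = u 0 a.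
  by rewrite /c (big_pred1 a) // => b; rewrite (inj_eq enum_val_inj).
have sum0 : \sum_(i <- s) c i *: grad (constr i) x = 0.
  rewrite big_uniq //= (eq_bigl (mem (sumset J1 J2))) => [|i]; last exact: memS.
  rewrite big_enum_val /= -[RHS]uE mulmx_sum_row; apply: eq_bigr => a _.
  by rewrite cE row_gradmx.
apply/rowP => a; rewrite -cE mxE; apply: (free_map_sum_eq0 us fs sum0).
by rewrite memS enum_valP.
Qed.

Lemma rank_grads_orth J1 J2 x :
  grads_free P J1 J2 x -> \rank (grads_orth P J1 J2 x) = (n - #|sumset J1 J2|)%N.
Proof.
move=> /grads_free_gradmx /eqP fr.
by rewrite (grads_orthE J1 J2 x) mxrank_ker mxrank_tr fr.
Qed.

Lemma sum_grad_gradmx A x (lam : 'I_kap + 'I_kap -> R) :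
  (forall i, i \notin A -> lam i = 0) ->
  \sum_i lam i *: grad (constr i) x =
  (\row_a lam (@enum_val _ (mem A) a)) *m gradmx A x.
Proof.
move=> lA; rewrite (bigID (mem A)) /= [X in _ + X]big1 ?addr0; last first.
  by move=> i /lA ->; rewrite scale0r.
rewrite big_enum_val mulmx_sum_row; apply: eq_bigr => a _.
by rewrite row_gradmx !mxE.
Qed.

(** Multipliers extended by 0; the index sets in each sum are disjoint, so at most one summand is
    nonzero. *)
Definition mpcc_coef x (m : mpcc_mult R kap) (i : 'I_kap + 'I_kap) : R :=
  match i with
  | inl j => (if j \in a01 P x then sigma1 m j else 0) +
             (if j \in a00 P x then rho1 m j else 0)
  | inr j => (if j \in a10 P x then sigma2 m j else 0) +
             (if j \in a00 P x then rho2 m j else 0)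
  end.

(** The minus signs come from the constraints [t - F], whose gradients are opposite to those of
    [F]. *)
Definition disj_coef t x (m : disj_mult R kap) (i : 'I_kap + 'I_kap) : R :=
  match i with
  | inl j => (if j \in N1 P x then nu1 m j else 0) -
             (if j \in H12 P t x then zeta1 m j else 0) -
             (if j \in H1 P t x then eta1 m j else 0)
  | inr j => (if j \in N2 P x then nu2 m j else 0) -
             (if j \in H12 P t x then zeta2 m j else 0) -
             (if j \in H2 P t x then eta2 m j else 0)
  end.

Lemma big_sum_type (h : 'I_kap + 'I_kap -> R) :
  \sum_i h i = \sum_j (h (inl j) + h (inr j)).
Proof. by rewrite big_sumType /= big_split. Qed.

Lemma mpcc_lagrE x m : mpcc_lagr P x m = lagr (obj P) constr (mpcc_coef x m) 0.
Proof.
apply/funext => y; rewrite /mpcc_lagr /lagr addr0 big_sum_type /=.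
rewrite -2!addrA -2!opprD; congr (_ - _).
rewrite big_mkcond /= [X in _ + (X + _)]big_mkcond /= [X in _ + (_ + X)]big_mkcond /=.
rewrite -!big_split /=; apply: eq_bigr => j _.
by do 3 case: ifP => _; ring.
Qed.

Lemma disj_lagrE t x m :
  exists c, disj_lagr P t x m = lagr (obj P) constr (disj_coef t x m) c.
Proof.
(* The parts of the terms on H_12, H_1 and H_2 that do not depend on [y]. *)
pose c1 j := if j \in H12 P t x then (zeta1 m j + zeta2 m j) * t else 0.
pose c2 j := if j \in H1 P t x then eta1 m j * t else 0.
pose c3 j := if j \in H2 P t x then eta2 m j * t else 0.
exists (- \sum_j (c1 j + c2 j + c3 j)); apply/funext => y.
rewrite /disj_lagr /lagr big_sum_type /= -addrA -opprD -!addrA -!opprD.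
congr (_ - _).
rewrite big_mkcond /= [X in _ + (X + _)]big_mkcond /=.
rewrite [X in _ + (_ + (X + _))]big_mkcond /=.
rewrite [X in _ + (_ + (_ + (X + _)))]big_mkcond /=.
rewrite [X in _ + (_ + (_ + (_ + X)))]big_mkcond /=.
rewrite -!big_split /=; apply: eq_bigr => j _; rewrite /c1 /c2 /c3.
by do 5 case: ifP => _; ring.
Qed.

Definition disj_active t x : {set 'I_kap + 'I_kap} :=
  sumset (H12 P t x :|: H1 P t x :|: N1 P x)%SET (H12 P t x :|: H2 P t x :|: N2 P x)%SET.

Definition mpcc_active x : {set 'I_kap + 'I_kap} :=
  sumset (a01 P x :|: a00 P x)%SET (a10 P x :|: a00 P x)%SET.

Lemma mpcc_activeP x i : mpcc_feasible P x -> (i \in mpcc_active x) = (constr i x == 0).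
Proof.
move=> fx; rewrite inE; case: i => j /=; rewrite !inE; have [_ f1 f2] := fx j.
  by rewrite -andb_orr (lt_def 0 (F2 P j x)) f2 andbT orNb andbT.
by rewrite -andb_orl (lt_def 0 (F1 P j x)) f1 andbT orNb.
Qed.

Lemma disj_activeP t x i :
  i \in disj_active t x -> constr i x = t \/ constr i x = 0.
Proof.
rewrite inE; case: i => j /=; rewrite !inE.
  by move=> /orP[/orP[/andP[/eqP ? _]|/andP[/eqP ? _]]|/eqP ?]; [left|left|right].
by move=> /orP[/orP[/andP[_ /eqP ?]|/andP[_ /eqP ?]]|/eqP ?]; [left|left|right].
Qed.

Lemma disj_coef_active t x m i : disj_coef t x m i != 0 -> i \in disj_active t x.
Proof.
by apply: contraR; rewrite inE; case: i => j /=; rewrite !finset.in_setU !negb_or;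
  move=> /andP[/andP[/negPf -> /negPf ->] /negPf ->]; rewrite !subr0.
Qed.

Lemma mpcc_coef_active x m i : mpcc_coef x m i != 0 -> i \in mpcc_active x.
Proof.
by apply: contraR; rewrite inE; case: i => j /=; rewrite !finset.in_setU !negb_or;
  move=> /andP[/negPf -> /negPf ->]; rewrite addr0.
Qed.

(** By DISJ-ND2 coefficients are positive on N_1, N_2 and negative on H_12, H_1, H_2. Outside H_12,
    two negative ones would put [j] in both H_1 and H_2, which exclude each other. *)
Lemma disj_biactiveP t x m j : 0 < t -> disj_nondegenerate P t x m ->
  (j \in H12 P t x) = (disj_coef t x m (inl j) < 0) && (disj_coef t x m (inr j) < 0).
Proof.
move=> t0 [_ _ [z12 e1 e2 v1 v2] _].
apply/idP/andP => [jH|[]].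
  have [p1 p2] := z12 j jH; move: (jH); rewrite inE => /andP[/eqP E1 /eqP E2].
  by split; rewrite /disj_coef jH !inE E1 E2 (gt_eqF t0) ltxx ?andbF /= sub0r subr0 oppr_lt0.
rewrite /disj_coef; have [//|jH] := boolP (j \in H12 P t x); rewrite !subr0.
have [jN1|jN1] := boolP (j \in N1 P x).
  have -> : (j \in H1 P t x) = false.
    by move: jN1; rewrite !inE => /eqP ->; rewrite eq_sym (gt_eqF t0).
  by rewrite subr0 ltNge (ltW (v1 j jN1)).
have [jN2 _|jN2] := boolP (j \in N2 P x).
  have -> : (j \in H2 P t x) = false.
    by move: jN2; rewrite !inE => /eqP ->; rewrite [0 == t]eq_sym (gt_eqF t0) andbF.
  by rewrite subr0 ltNge (ltW (v2 j jN2)).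
have [jH1 _|_] := boolP (j \in H1 P t x); last by rewrite subr0 ltxx.
have [jH2|_] := boolP (j \in H2 P t x); last by rewrite subr0 ltxx.
by move: jH1 jH2; rewrite !inE => /andP[_ l1] /andP[_ /eqP E]; rewrite E ltxx in l1.
Qed.

Lemma disj_BIE t x m : disj_nondegenerate P t x m -> disj_BI P t x m = #|H12 P t x|.
Proof.
move=> [_ _ [z12 _ _ _ _] _]; apply: eq_card => j; rewrite inE.
by apply: andb_idr => /z12[p1 p2]; rewrite !gt_eqF.
Qed.

(** MPCC-ND2 keeps both multipliers on a_00 away from 0, so only those on a_01 and a_10 can
    vanish. *)
Lemma card_vanishing_active x m : mpcc_nondegenerate P x m ->
  (#|[set i in mpcc_active x | mpcc_coef x m i == 0%R]%SET| <= n_vanishing P x m)%N.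
Proof.
move=> [_ _ nd2 _].
pose S1 := [set j in a01 P x | sigma1 m j == 0]%SET.
pose S2 := [set j in a10 P x | sigma2 m j == 0]%SET.
have sub : [set i in mpcc_active x | mpcc_coef x m i == 0]%SET \subset
    ((@inl 'I_kap 'I_kap) @: S1 :|: (@inr 'I_kap 'I_kap) @: S2)%SET.
  apply/fintype.subsetP => i; rewrite inE => /andP[]; rewrite finset.in_setU.
  have rho j : j \in a00 P x -> (rho1 m j != 0) && (rho2 m j != 0).
    by move=> /nd2 r; rewrite -negb_or -mulf_eq0 gt_eqF.
  case: i => j; rewrite inE finset.in_setU /mpcc_coef.
    have [j00|_] := boolP (j \in a00 P x).
      have -> : (j \in a01 P x) = false.
        by move: j00; rewrite !inE => /andP[_ /eqP ->]; rewrite ltxx andbF.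
      by have /andP[/negPf r1 _] := rho j j00; rewrite add0r r1.
    by rewrite orbF addr0 => j01; rewrite j01 => s0; rewrite imset_f // /S1 inE j01.
  have [j00|_] := boolP (j \in a00 P x).
    have -> : (j \in a10 P x) = false.
      by move: j00; rewrite !inE => /andP[/eqP -> _]; rewrite ltxx.
    by have /andP[_ /negPf r2] := rho j j00; rewrite add0r r2.
  by rewrite orbF addr0 => j10; rewrite j10 => s0; rewrite orbC imset_f // /S2 inE j10.
rewrite (leq_trans (subset_leq_card sub)) // (leq_trans (leq_card_setU _ _)) //.
by rewrite leq_add // leq_imset_card.
Qed.

Lemma cvg_gradmx (T : Type) (F : set_system T) {FF : Filter F} A (y : T -> 'rV[R]_n) x :
  (forall i, C2 (constr i)) -> y @ F --> x ->
  mx_cvg F (fun k => gradmx A (y k)) (gradmx A x).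
Proof.
move=> gC2 yx a b; rewrite mxE.
rewrite (_ : (fun k => _) = (fun k => grad (constr (@enum_val _ (mem A) a)) (y k) 0 b)).
  exact: cvg_grad.
by apply/funext => k; rewrite mxE.
Qed.

Lemma C2_constr i : C2_data P -> C2 (constr i).
Proof. by move=> [_ c1 c2]; case: i => j; [exact: c1|exact: c2]. Qed.

Lemma disj_gradE t x m : C2_data P -> disj_nondegenerate P t x m ->
  grad (obj P) x = \sum_i disj_coef t x m i *: grad (constr i) x.
Proof.
move=> PC2 [[_ g0 _ _ _] _ _ _]; have [C2f _ _] := PC2.
apply: subr0_eq; rewrite -[RHS]g0; have [c ->] := disj_lagrE t x m.
exact/esym/(grad_lagr _ _ _ C2f (fun i => C2_constr i PC2)).
Qed.

Lemma mpcc_gradE x m : C2_data P -> mpcc_nondegenerate P x m ->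
  grad (obj P) x = \sum_i mpcc_coef x m i *: grad (constr i) x.
Proof.
move=> PC2 [[_ g0 _] _ _ _]; have [C2f _ _] := PC2.
apply: subr0_eq; rewrite -[RHS]g0 mpcc_lagrE.
exact/esym/(grad_lagr _ _ _ C2f (fun i => C2_constr i PC2)).
Qed.

(** * Passage to the limit along the sequence of stationary points *)

Section Limit.
Variables (t : nat -> R) (x : nat -> 'rV[R]_n) (mt : nat -> disj_mult R kap).
Variables (xbar : 'rV[R]_n) (m : mpcc_mult R kap).
Hypotheses (PC2 : C2_data P) (tpos : forall k, 0 < t k) (t0 : t @ \oo --> (0 : R)).
Hypothesis ndx : forall k, disj_nondegenerate P (t k) (x k) (mt k).
Hypotheses (xxbar : x @ \oo --> xbar) (ndm : mpcc_nondegenerate P xbar m).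

Let gC2 i : C2 (constr i). Proof. exact: C2_constr. Qed.

Let A := mpcc_active xbar.

(** A constraint inactive at [xbar] is positive there, hence eventually larger than [t k]; this
    excludes both values, [t k] and 0, of an active one. *)
Lemma near_active_sub :
  \forall k \near \oo, forall i, i \in disj_active (t k) (x k) -> i \in A.
Proof.
apply: filter_forall => i; have [iA|iA] := boolP (i \in A); first exact: filterE.
have [[feas _ _] _ _ _] := ndm.
have gi : 0 < constr i xbar.
  rewrite lt_def -mpcc_activeP // iA /=.
  by case: (i) => j; have [] := feas j.
have cg : (fun k => constr i (x k) - t k) @ \oo --> constr i xbar - 0.
  apply: cvgB => //; apply: continuous_cvg => //.
  by have [cg _ _] := gC2 i; exact: cg.
have ng : \forall k \near \oo, 0 < constr i (x k) - t k.
  by apply: cvgr_gt cg _ _; rewrite subr0.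
apply: filterS ng => k gk /disj_activeP[E|E]; move: gk; rewrite E.
  by rewrite subrr ltxx.
by rewrite sub0r oppr_gt0 ltNge ltW.
Qed.

(** Off [A] both coefficients are eventually 0. On [A], stationarity writes the gradient of the
    objective as a combination of the rows of [gradmx A], which are independent at [xbar], so
    [cvg_coefficients] applies. *)
Lemma cvg_coef i : disj_coef (t k) (x k) (mt k) i @[k --> \oo] --> mpcc_coef xbar m i.
Proof.
have [_ licq _ _] := ndm.
have [iA|iA] := boolP (i \in A); last first.
  rewrite (_ : mpcc_coef xbar m i = 0); last first.
    by apply/eqP; apply: contraNT iA => /mpcc_coef_active.
  apply: cvg_near_cst; apply: filterS near_active_sub => k sub.
  by apply/eqP; apply: contraNT iA => /disj_coef_active/sub.
pose c_ k := \row_a disj_coef (t k) (x k) (mt k) (@enum_val _ (mem A) a).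
pose c := \row_a mpcc_coef xbar m (@enum_val _ (mem A) a).
have cc : mx_cvg \oo c_ c.
  have fr : row_free (gradmx A xbar) := grads_free_gradmx licq.
  have cg : mx_cvg \oo (fun k => gradmx A (x k)) (gradmx A xbar) by exact: cvg_gradmx.
  apply: (cvg_coefficients cg fr).
  have <- : grad (obj P) xbar = c *m gradmx A xbar.
    rewrite (mpcc_gradE PC2 ndm); apply: sum_grad_gradmx => j jA.
    by apply/eqP; apply: contraNT jA => /mpcc_coef_active.
  have [C2f _ _] := PC2.
  have cf : mx_cvg \oo (fun k => grad (obj P) (x k)) (grad (obj P) xbar).
    exact: cvg_grad.
  move=> a b; apply: cvg_trans (cf a b); apply: near_eq_cvg.
  apply: filterS near_active_sub => k sub; rewrite (disj_gradE PC2 (ndx k)).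
  rewrite (sum_grad_gradmx (A := A)) // => j jA.
  by apply/eqP; apply: contraNT jA => /disj_coef_active/sub.
have := cc 0 (enum_rank_in iA i); rewrite /c mxE enum_rankK_in //.
rewrite (_ : (fun k => c_ k _ _) = (fun k => disj_coef (t k) (x k) (mt k) i)) //.
by apply/funext => k; rewrite mxE enum_rankK_in.
Qed.

Lemma near_coef_sign : \forall k \near \oo, forall i,
  (0 < mpcc_coef xbar m i -> 0 < disj_coef (t k) (x k) (mt k) i) /\
  (mpcc_coef xbar m i < 0 -> disj_coef (t k) (x k) (mt k) i < 0).
Proof.
apply: filter_forall => i.
have [l|l|_] := ltgtP (mpcc_coef xbar m i) 0.
- have h : \forall k \near \oo, disj_coef (t k) (x k) (mt k) i < 0.
    exact: cvgr_lt (@cvg_coef i) _ l.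
  by apply: filterS h => k lk; split.
- have h : \forall k \near \oo, 0 < disj_coef (t k) (x k) (mt k) i.
    exact: cvgr_gt (@cvg_coef i) _ l.
  by apply: filterS h => k lk; split.
- by apply: filterE.
Qed.

Lemma near_BI : \forall k \near \oo, disj_BI P (t k) (x k) (mt k) = mpcc_BI P xbar m.
Proof.
have [[feas _ _] _ nd2 _] := ndm.
apply: filterS2 near_active_sub near_coef_sign => k sub sgn.
rewrite (disj_BIE (ndx k)); apply: eq_card => j; rewrite [RHS]inE.
have coef00 : j \in a00 P xbar ->
    mpcc_coef xbar m (inl j) = rho1 m j /\ mpcc_coef xbar m (inr j) = rho2 m j.
  move=> j00; have [e1 e2] : F1 P j xbar = 0 /\ F2 P j xbar = 0.
    by move: j00; rewrite inE => /andP[/eqP ? /eqP ?].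
  by rewrite /= j00 !inE e1 e2 ltxx andbF /= !add0r.
apply/idP/andP => [jH|[j00 /andP[r1 r2]]]; last first.
  rewrite (disj_biactiveP j (tpos k) (ndx k)).
  by have [c1 c2] := coef00 j00; rewrite !(sgn _).2 ?c1 ?c2.
(* Biactivity at [x k] makes both constraints active there, hence at [xbar]. *)
have j00 : j \in a00 P xbar.
  have i1 : (inl j : 'I_kap + 'I_kap) \in A by apply: sub; rewrite inE /= !finset.in_setU jH.
  have i2 : (inr j : 'I_kap + 'I_kap) \in A by apply: sub; rewrite inE /= !finset.in_setU jH.
  by move: i1 i2; rewrite !mpcc_activeP // inE /= => -> ->.
have [c1 c2] := coef00 j00; split=> //.
move: jH; rewrite (disj_biactiveP j (tpos k) (ndx k)) => /andP[d1 d2].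
(* A positive [rho1] would persist as a positive coefficient at [x k]; so [rho1] is negative and
   MPCC-ND2 gives [rho2] the same sign. *)
have := nd2 j j00; have [l1|l1|->] := ltgtP (rho1 m j) 0.
- by rewrite nmulr_rgt0 // => ->.
- by have [h _] := sgn (inl j); move: d1; rewrite ltNge ltW // h ?c1.
- by rewrite mul0r ltxx.
Qed.

Lemma near_QI : \forall k \near \oo,
  (mpcc_QI P xbar m <= disj_QI P (t k) (x k) (mt k)
     <= mpcc_QI P xbar m + n_vanishing P xbar m)%N.
Proof.
have [C2f _ _] := PC2; have [[feas _ _] licq _ nd3] := ndm.
have lagrE k : exists c,
    disj_lagr P (t k) (x k) (mt k) = lagr (obj P) constr (disj_coef (t k) (x k) (mt k)) c.
  exact: disj_lagrE.
have fr : row_free (gradmx A xbar) := grads_free_gradmx licq.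
have cg : mx_cvg \oo (fun k => gradmx A (x k)) (gradmx A xbar) by exact: cvg_gradmx.
apply: (near_index_bounds cg fr
  (H_ := fun k => hess (disj_lagr P (t k) (x k) (mt k)) (x k))
  (S_ := fun k => disj_tangent P (t k) (x k))
  (H := hess (mpcc_lagr P xbar m) xbar) (S := mpcc_tangent P xbar)).
- move=> a b.
  (* The Hessians of the Lagrange functions converge because the coefficients do and the data are of
     class C2. *)
  have cl : (fun k => hess (obj P) (x k) a b - \sum_i disj_coef (t k) (x k) (mt k) i *
      hess (constr i) (x k) a b) @ \oo --> hess (obj P) xbar a b -
      \sum_i mpcc_coef xbar m i * hess (constr i) xbar a b.
    have ch f : C2 f -> hess f (x k) a b @[k --> \oo] --> hess f xbar a b.
      by move=> fC2; have := cvg_hess fC2 xxbar; apply.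
    apply: cvgB; first exact: ch.
    by apply: cvg_sumr => i; exact: cvgM (@cvg_coef i) (ch _ (gC2 i)).
  apply: cvg_ext cl => [k|].
    by have [c ->] := lagrE k; exact/esym/hess_lagr.
  by rewrite mpcc_lagrE; exact/esym/hess_lagr.
- by apply: hess_sym; rewrite mpcc_lagrE; exact: C2_lagr.
- by move=> k; have [c ->] := lagrE k; apply: hess_sym; exact: C2_lagr.
- by rewrite /mpcc_tangent grads_orthE.
- exact: nd3.
- by move=> k; have [] := ndx k.
(* Fewer active constraints leave a larger tangent space. *)
- apply: filterS near_active_sub => k sub.
  rewrite /disj_tangent grads_orthE; apply/rV_subP => u /kermx_gradmxP h.
  by apply/kermx_gradmxP => i /sub; exact: h.
- apply: filterS2 near_active_sub near_coef_sign => k sub sgn.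
  have [_ dlicq _ _] := ndx k.
  rewrite (rank_grads_orth dlicq) (rank_grads_orth licq).
  (* Dimensions are truncated differences from [n]; the inequality survives truncation. *)
  have sub_le a d s : (a <= d + s -> n - d <= n - a + s)%N by lia.
  apply: (sub_le #|A| #|disj_active (t k) (x k)|).
  apply: leq_trans (leq_add (leqnn _) (card_vanishing_active ndm)).
  apply: leq_trans (leq_card_setU _ _); apply: subset_leq_card.
  (* An index in [A] with nonzero coefficient at [xbar] has a nonzero one at [x k], so it is active
     there too. *)
  apply/fintype.subsetP => i iA; rewrite finset.in_setU [X in _ || X]inE iA /=.
  have [|//|] := ltgtP (mpcc_coef xbar m i) 0; rewrite ?orbT // orbF => l.
    by apply: (disj_coef_active (m := mt k)); rewrite lt_eqF // (sgn i).2.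
  by apply: (disj_coef_active (m := mt k)); rewrite gt_eqF // (sgn i).1.
Qed.

End Limit.
End Problem.

Theorem theorem3 (R : realType) (n kap : nat) (P : data R n kap)
    (t : nat -> R) (x : nat -> 'rV[R]_n) (mt : nat -> disj_mult R kap)
    (xbar : 'rV[R]_n) (m : mpcc_mult R kap) (disjQI disjBI : nat) :
  C2_data P ->
  (forall k, 0 < t k) ->
  t @ \oo --> (0 : R) ->
  (forall k, disj_nondegenerate P (t k) (x k) (mt k)) ->
  (forall k, disj_QI P (t k) (x k) (mt k) = disjQI) ->
  (forall k, disj_BI P (t k) (x k) (mt k) = disjBI) ->
  x @ \oo --> xbar ->
  mpcc_nondegenerate P xbar m ->
  let s := n_vanishing P xbar m in
  [/\ (maxn (disjQI - s) 0 <= mpcc_QI P xbar m <= disjQI)%N /\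
      mpcc_BI P xbar m = disjBI,
      forall k, let disjCI := disj_CI P (t k) (x k) (mt k) in
        (maxn (disjCI - s) 0 <= mpcc_CI P xbar m <= disjCI)%N &
      mpcc_ND4 P xbar m ->
        mpcc_QI P xbar m = disjQI /\
        forall k, mpcc_CI P xbar m = disj_CI P (t k) (x k) (mt k)].
Proof.
move=> PC2 tpos t0 ndx QIE BIE xxbar ndm s.
(* Both indices are constant along the sequence, so a single [k] satisfying the two eventual
   properties suffices. *)
have [k [/andP[QI1 QI2] BI]] := filter_ex
  (filterI (near_QI PC2 tpos t0 ndx xxbar ndm) (near_BI PC2 tpos t0 ndx xxbar ndm)).
move: QI1 QI2 BI; rewrite QIE BIE -/s => QI1 QI2 BI.
have CIE l : disj_CI P (t l) (x l) (mt l) = (disjQI + disjBI)%N.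
  by rewrite /disj_CI QIE BIE.
split; first by split; [lia | rewrite BI].
  by move=> l; rewrite CIE /mpcc_CI -BI; lia.
(* MPCC-ND4 empties both sets counted by [s], and the two bounds on the quadratic index coincide. *)
move=> [nz1 nz2]; have s0 : s = 0%N.
  apply/eqP; rewrite addn_eq0 !cards_eq0.
  by apply/andP; split; apply/eqP/setP => j; rewrite !inE;
    apply/negP => /andP[ja]; apply/negP; [apply: nz1 | apply: nz2]; rewrite inE.
have QI : mpcc_QI P xbar m = disjQI by lia.
by split=> // l; rewrite CIE /mpcc_CI QI BI.
Qed.
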